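(* Let $i\in\mathbb{N}$ (so $i\ge 1$) and let $c_{(\theta_0,\ldots,\theta_i)}:(\mathbb{K},S)\to(\mathbb{K}^2,0)$ be a multicusp. Then, as $\mathbb{K}$-vector spaces, $$\frac{m_0^i\theta_0(2)}{m_0^{i+1}\theta_0(2)}=\bigoplus_{j=0}^{i}\ker\left({}_i\overline{\omega}\,c_{\hat{\theta}_j}\right),$$ i.e. the kernels of the maps ${}_i\overline{\omega}\,c_{\hat{\theta}_j}$, $0\le j\le i$, are subspaces of $m_0^i\theta_0(2)/m_0^{i+1}\theta_0(2)$ whose sum is the whole space and is direct.
   Context: $\mathbb{K}=\mathbb{R}$ or $\mathbb{C}$; all germs are $C^\infty$ (if $\mathbb{K}=\mathbb{R}$) or holomorphic (if $\mathbb{K}=\mathbb{C}$). For a finite set $S\subset\mathbb{K}^n$, $C_S$ is the algebra of function germs $(\mathbb{K}^n,S)\to\mathbb{K}$, and $C_0$ that of germs $(\mathbb{K}^p,0)\to\mathbb{K}$; $m_0^\ell\subset C_0$ is the ideal of germs whose Taylor series vanish up to order $\ell-1$ ($m_0^0=C_0$). For a multigerm $f:(\mathbb{K}^n,S)\to(\mathbb{K}^p,0)$: $\theta_S(f)\cong C_S^{\,p}$ is the $C_S$-module of vector fields along $f$; $\theta_S(n)=\theta_S(\mathrm{id}_{(\mathbb{K}^n,S)})$, $\theta_0(p)=\theta_{\{0\}}(\mathrm{id}_{(\mathbb{K}^p,0)})\cong C_0^{\,p}$; $f^*u=u\circ f$; $f^*m_0^\ell\,\theta_S(f)$ denotes the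 $C_S$-submodule of $\theta_S(f)$ generated by $\{(u\circ f)\,v: u\in m_0^\ell, v\in\theta_S(f)\}$; $tf(\eta)=df\circ\eta$ for $\eta\in\theta_S(n)$, $\omega f(\xi)=\xi\circ f$ for $\xi\in\theta_0(p)$; $T\mathcal{R}_e(f)=tf(\theta_S(n))$. For $i\ge0$ the $\mathbb{K}$-linear map $${}_i\overline{\omega}f:\frac{m_0^i\theta_0(p)}{m_0^{i+1}\theta_0(p)}\to\frac{f^*m_0^i\theta_S(f)}{T\mathcal{R}_e(f)\cap f^*m_0^i\theta_S(f)+f^*m_0^{i+1}\theta_S(f)},\quad [\xi]\mapsto[\omega f(\xi)].$$ Multicusps: let $c(x)=(x^2,x^3)$ and $R_\theta$ the linear map of $\mathbb{K}^2$ with matrix $\begin{pmatrix}\cos\theta&-\sin\theta\\ \sin\theta&\cos\theta\end{pmatrix}$. Let $\theta_0,\ldots,\theta_i$ be real numbers with $0\le\theta_j<2\pi$ and $0\ne|\theta_j-\theta_k|\ne\pi$ for $j\ne k$. Let $S=\{s_0,\ldots,s_i\}\subset\mathbb{K}$ be distinct points and $c_{\theta_j}:(\mathbb{K},s_j)\to(\mathbb{K}^2,0)$, $c_{\theta_j}(x)=R_{\theta_j}(c(x-s_j))$. The multigerm $\{c_{\theta_0},\ldots,c_{\theta_i}\}:(\mathbb{K},S)\to(\mathbb{K}^2,0)$ is the multicusp $c_{(\theta_0,\ldots,\theta_i)}$. For $i\ge1$, $c_{\hat{\theta}_j}:(\mathbb{K},S\setminus\{s_j\})\to(\mathbb{K}^2,0)$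 is the multigerm obtained by removing the branch $c_{\theta_j}$. *)

(* Defs.v *)
From Stdlib Require Import Reals List.
Open Scope R_scope.

Inductive Kfield := KR | KC.

Definition Kt (k : Kfield) : Type :=
  match k with KR => R | KC => (R * R)%type end.

Definition KofR (k : Kfield) (r : R) : Kt k :=
  match k return Kt k with KR => r | KC => (r, 0) end.

Definition Kadd (k : Kfield) : Kt k -> Kt k -> Kt k :=
  match k return Kt k -> Kt k -> Kt k with
  | KR => Rplus
  | KC => fun x y => (fst x + fst y, snd x + snd y)
  end.

Definition Kopp (k : Kfield) : Kt k -> Kt k :=
  match k return Kt k -> Kt k with
  | KR => Ropp
  | KC => fun x => (- fst x, - snd x)
  end.

Definition Kmul (k : Kfield) : Kt k -> Kt k -> Kt k :=
  match k return Kt k -> Kt k -> Kt k with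
  | KR => Rmult
  | KC => fun x y => (fst x * fst y - snd x * snd y, fst x * snd y + snd x * fst y)
  end.

Definition Knorm (k : Kfield) : Kt k -> R :=
  match k return Kt k -> R with
  | KR => Rabs
  | KC => fun x => sqrt (fst x * fst x + snd x * snd x)
  end.

Definition Ksub (k : Kfield) (x y : Kt k) : Kt k := Kadd k x (Kopp k y).

Fixpoint Kpow (k : Kfield) (x : Kt k) (n : nat) : Kt k :=
  match n with O => KofR k 1 | S n' => Kmul k x (Kpow k x n') end.

Definition P2 (k : Kfield) : Type := (Kt k * Kt k)%type.
Definition P2zero (k : Kfield) : P2 k := (KofR k 0, KofR k 0).
Definition P2add (k : Kfield) (u v : P2 k) : P2 k :=
  (Kadd k (fst u) (fst v), Kadd k (snd u) (snd v)).
Definition P2sub (k : Kfield) (u v : P2 k) : P2 k :=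
  (Ksub k (fst u) (fst v), Ksub k (snd u) (snd v)).
Definition P2scale (k : Kfield) (a : Kt k) (v : P2 k) : P2 k :=
  (Kmul k a (fst v), Kmul k a (snd v)).

Fixpoint P2sum (k : Kfield) (n : nat) (F : nat -> P2 k -> P2 k) (p : P2 k) : P2 k :=
  match n with
  | O => P2zero k
  | S n' => P2add k (P2sum k n' F p) (F n' p)
  end.

Definition hasderiv (k : Kfield) (g : Kt k -> Kt k) (x l : Kt k) : Prop :=
  forall eps, 0 < eps -> exists delta, 0 < delta /\
    forall h, Knorm k h < delta ->
      Knorm k (Ksub k (Ksub k (g (Kadd k x h)) (g x)) (Kmul k l h)) <= eps * Knorm k h.

Definition Kcont_at (k : Kfield) (g : Kt k -> Kt k) (x : Kt k) : Prop :=
  forall eps, 0 < eps -> exists delta, 0 < delta /\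
    forall y, Knorm k (Ksub k y x) < delta -> Knorm k (Ksub k (g y) (g x)) < eps.

Inductive iter_d1 (k : Kfield) (a : Kt k) (r : R) :
    nat -> (Kt k -> Kt k) -> (Kt k -> Kt k) -> Prop :=
| d1_0 g : iter_d1 k a r O g g
| d1_S n g g' h :
    (forall x, Knorm k (Ksub k x a) < r -> hasderiv k g x (g' x)) ->
    iter_d1 k a r n g' h -> iter_d1 k a r (S n) g h.

(** [g] defines a C^infty (K = R) / holomorphic (K = C) germ at [a] *)
Definition smooth1 (k : Kfield) (a : Kt k) (g : Kt k -> Kt k) : Prop :=
  exists r, 0 < r /\ forall n, exists h, iter_d1 k a r n g h /\
    forall x, Knorm k (Ksub k x a) < r -> Kcont_at k h x.

Definition ball2 (k : Kfield) (a : P2 k) (r : R) (p : P2 k) : Prop :=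
  Knorm k (Ksub k (fst p) (fst a)) < r /\ Knorm k (Ksub k (snd p) (snd a)) < r.

Definition Kcont2_at (k : Kfield) (g : P2 k -> Kt k) (p : P2 k) : Prop :=
  forall eps, 0 < eps -> exists delta, 0 < delta /\
    forall q, ball2 k p delta q -> Knorm k (Ksub k (g q) (g p)) < eps.

Definition pd2 (k : Kfield) (b : bool) (g : P2 k -> Kt k) (h : P2 k -> Kt k) (p : P2 k) : Prop :=
  if b then hasderiv k (fun t => g (fst p, t)) (snd p) (h p)
  else hasderiv k (fun t => g (t, snd p)) (fst p) (h p).

Inductive iter_d2 (k : Kfield) (a : P2 k) (r : R) :
    list bool -> (P2 k -> Kt k) -> (P2 k -> Kt k) -> Prop :=
| d2_nil g : iter_d2 k a r nil g g
| d2_cons b w g g' h :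
    (forall p, ball2 k a r p -> pd2 k b g g' p) ->
    iter_d2 k a r w g' h -> iter_d2 k a r (b :: w) g h.

Definition smooth2 (k : Kfield) (a : P2 k) (g : P2 k -> Kt k) : Prop :=
  exists r, 0 < r /\ forall w, exists h, iter_d2 k a r w g h /\
    forall p, ball2 k a r p -> Kcont2_at k h p.

(** * m_0^l : germs at 0 in K^2 whose Taylor series vanish up to order l-1,
      i.e. all partial derivatives of order < l vanish at 0 *)
Definition mem_m (k : Kfield) (l : nat) (u : P2 k -> Kt k) : Prop :=
  smooth2 k (P2zero k) u /\
  forall r w h, 0 < r -> (length w < l)%nat ->
    iter_d2 k (P2zero k) r w u h -> h (P2zero k) = KofR k 0.

Definition mem_mtheta (k : Kfield) (l : nat) (xi : P2 k -> P2 k) : Prop :=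
  mem_m k l (fun p => fst (xi p)) /\ mem_m k l (fun p => snd (xi p)).

(** * Multigerms (K, S) -> (K^2, 0).
   A multigerm is given by an index predicate [J] (the branches), base points
   [s m] (S = {s m | J m}) and branch maps [f m : K -> K^2] (germ at s m).
   Germs on (K,S) are identified with families of germs at the points of S,
   i.e. C_S = prod_m C_{s m}.  A vector field along f is [v : nat -> K -> K^2]. *)
Definition vf_smooth (k : Kfield) (J : nat -> Prop) (s : nat -> Kt k)
    (v : nat -> Kt k -> P2 k) : Prop :=
  forall m, J m -> smooth1 k (s m) (fun x => fst (v m x)) /\
                   smooth1 k (s m) (fun x => snd (v m x)).

Definition germ_eqS (k : Kfield) (J : nat -> Prop) (s : nat -> Kt k)
    (v w : nat -> Kt k -> P2 k) : Prop :=
  forall m, J m -> exists r, 0 < r /\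
    forall x, Knorm k (Ksub k x (s m)) < r -> v m x = w m x.

Definition TRe (k : Kfield) (J : nat -> Prop) (s : nat -> Kt k)
    (f : nat -> Kt k -> P2 k) (a : nat -> Kt k -> P2 k) : Prop :=
  exists (eta : nat -> Kt k -> Kt k) (D : nat -> Kt k -> P2 k),
    (forall m, J m -> smooth1 k (s m) (eta m)) /\
    (forall m, J m -> exists r, 0 < r /\
       forall x, Knorm k (Ksub k x (s m)) < r ->
         hasderiv k (fun t => fst (f m t)) x (fst (D m x)) /\
         hasderiv k (fun t => snd (f m t)) x (snd (D m x)) /\
         a m x = P2scale k (eta m x) (D m x)).

Definition pullmod (k : Kfield) (l : nat) (J : nat -> Prop) (s : nat -> Kt k)
    (f : nat -> Kt k -> P2 k) (a : nat -> Kt k -> P2 k) : Prop :=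
  exists L : list ((P2 k -> Kt k) * (nat -> Kt k -> P2 k)),
    (forall uv, In uv L -> mem_m k l (fst uv) /\ vf_smooth k J s (snd uv)) /\
    germ_eqS k J s a
      (fun m x => fold_right
          (fun uv acc => P2add k (P2scale k (fst uv (f m x)) (snd uv m x)) acc)
          (P2zero k) L).

(** representatives xi in m_0^i theta_0(2) of the kernel of  _i omega-bar f :
    omega f (xi) = xi o f  lies in  (TR_e(f) /\ f^* m^i theta_S(f)) + f^* m^{i+1} theta_S(f) *)
Definition ker_omega (k : Kfield) (i : nat) (J : nat -> Prop) (s : nat -> Kt k)
    (f : nat -> Kt k -> P2 k) (xi : P2 k -> P2 k) : Prop :=
  mem_mtheta k i xi /\
  exists a b : nat -> Kt k -> P2 k,
    TRe k J s f a /\ pullmod k i J s f a /\ pullmod k (S i) J s f b /\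
    germ_eqS k J s (fun m x => xi (f m x)) (fun m x => P2add k (a m x) (b m x)).

Definition rotK (k : Kfield) (th : R) (v : P2 k) : P2 k :=
  (Ksub k (Kmul k (KofR k (cos th)) (fst v)) (Kmul k (KofR k (sin th)) (snd v)),
   Kadd k (Kmul k (KofR k (sin th)) (fst v)) (Kmul k (KofR k (cos th)) (snd v))).

Definition cuspK (k : Kfield) (x : Kt k) : P2 k := (Kpow k x 2, Kpow k x 3).

Definition multicusp (k : Kfield) (th : nat -> R) (s : nat -> Kt k) :
    nat -> Kt k -> P2 k :=
  fun m x => rotK k (th m) (cuspK k (Ksub k x (s m))).

Definition Jhat (i j : nat) (m : nat) : Prop := (m <= i)%nat /\ m <> j.

(* Main.v *)
(** On the m-th branch write v = (cos th_m, sin th_m), w for v turned by a right angle and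
    t = x - s_m, so that the branch is t^2 (v + t w) with velocity t (2 v + 3 t w).  For the
    leading form P of degree i of xi, put N = x P_2 - y P_1.  Comparing the v- and
    w-components of xi o f with a multiple of the velocity modulo t^(2i+2), xi satisfies the
    kernel condition on this branch iff N(v) = 0 and 2 dN(v)(w) = <P(v), v>.  By Euler's
    identity this says precisely that the form
      psi P = P - 2 (dN/dy, - dN/dx)
    of degree i vanishes at v.  Since psi is bijective on pairs of forms of degree i, both
    claims reduce to Lagrange interpolation of forms of degree i at the i + 1 pairwise
    distinct lines spanned by the v's.  A germ u in m_0^i has a leading form by induction on
    i: if A and B are leading forms of du/dx and du/dy, then dA/dy = dB/dx by the symmetry of
    second derivatives, and (x A + y B) / i is the leading form of u. *)
Require Import Defs.
From Stdlib Require Import Reals List.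
Open Scope R_scope.
From Stdlib Require Import Lra Lia Ring FunctionalExtensionality.
From Coquelicot Require Import Coquelicot.

(* The branches decouple: on branch m every element of f^* m_0^l theta(f) has order at least 2l in
   t, and conversely any polynomial field divisible by t^(2l) on all branches lies in this module,
   since the coefficient fields may be chosen independently on each branch. Membership thus becomes
   a comparison of orders in t, and no division theorem for smooth germs is required. The unknown
   multiple eta of the velocity is handled in two ways. To derive the two conditions on P it is
   eliminated by pairing with 2 w - 3 t v, which is orthogonal to 2 v + 3 t w. To construct a kernel
   element it is read off the v-component, eta = t^(2i-1) <P(v + t w), v> / 2, which is a polynomial
   because i >= 1. The map psi is bijective because it multiplies N by the nonzero integer 2i + 3,
   and P is recovered from psi P and the derivatives of N. Real and complex germs are treated
   together: theorems of real analysis enter only through real and imaginary parts along real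
   segments. *)
Declare Scope K_scope.
Delimit Scope K_scope with K.

Arguments Knorm k x%_K.
Arguments Kadd k x%_K y%_K.
Arguments Kmul k x%_K y%_K.
Arguments Ksub k x%_K y%_K.
Arguments Kopp k x%_K.
Arguments Kpow k x%_K n%_nat.
Arguments KofR k r%_R.

(** * The field K: ring structure, absolute value, inverses *)

Section Field.
Context {k : Kfield}.
Local Notation K := (Kt k).
Local Notation "0" := (KofR k 0) : K_scope.
Local Notation "1" := (KofR k 1) : K_scope.
Local Infix "+" := (Kadd k) : K_scope.
Local Infix "*" := (Kmul k) : K_scope.
Local Infix "-" := (Ksub k) : K_scope.
Local Notation "- x" := (Kopp k x) : K_scope.
Local Notation norm := (Knorm k).
Local Notation "x ^ n" := (Kpow k x n) : K_scope.
Local Open Scope K_scope.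

Lemma K_ring_theory :
  ring_theory (0 : K) 1 (Kadd k) (Kmul k) (Ksub k) (Kopp k) eq.
Proof.
  destruct k; split; simpl; intros; try reflexivity; unfold Ksub; simpl;
    try ring; apply injective_projections; simpl; ring.
Qed.

Add Ring K_ring : K_ring_theory.

Lemma Knorm_KC (z : C) : Knorm KC z = Cmod z.
Proof. unfold Cmod; simpl. f_equal; ring. Qed.

Lemma Knorm_pos (x : K) : 0 <= norm x.
Proof. destruct k; [apply Rabs_pos | apply sqrt_pos]. Qed.

Lemma Knorm_triang (x y : K) : norm (x + y) <= norm x + norm y.
Proof.
  destruct k; [apply Rabs_triang |].
  rewrite !Knorm_KC; apply Cmod_triangle.
Qed.

Lemma Knorm_mul (x y : K) : norm (x * y) = (norm x * norm y)%R.
Proof.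
  destruct k; [apply Rabs_mult |].
  rewrite !Knorm_KC; apply Cmod_mult.
Qed.

Lemma Knorm_opp (x : K) : norm (- x) = norm x.
Proof. destruct k; [apply Rabs_Ropp | rewrite !Knorm_KC; apply Cmod_opp]. Qed.

Lemma Knorm_eq0 (x : K) : norm x = 0%R -> x = 0.
Proof.
  destruct k; simpl.
  - intros H; destruct (Req_dec x 0) as [| n]; [assumption |].
    now apply Rabs_no_R0 in n.
  - intros H; apply Cmod_eq_0; now rewrite <- Knorm_KC.
Qed.

Lemma Knorm_KofR (r : R) : norm (KofR k r) = Rabs r.
Proof. destruct k; [reflexivity | rewrite Knorm_KC; apply Cmod_R]. Qed.

Lemma Knorm0 : norm ((0 : K)) = 0%R.
Proof. rewrite Knorm_KofR; apply Rabs_R0. Qed.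

Lemma Knorm1 : norm ((1 : K)) = 1%R.
Proof. rewrite Knorm_KofR; apply Rabs_R1. Qed.

Lemma Knorm_sub_triang (x y : K) : norm (x - y) <= norm x + norm y.
Proof.
  replace (x - y) with (x + - y) by ring.
  rewrite <- (Knorm_opp y); apply Knorm_triang.
Qed.

Lemma Knorm_pow (x : K) n : norm (x ^ n) = (norm x ^ n)%R.
Proof. induction n; simpl; [apply Knorm1 | now rewrite Knorm_mul, IHn]. Qed.

Lemma KofR_add (a b : R) : KofR k (a + b) = KofR k a + KofR k b.
Proof. destruct k; simpl; [reflexivity | f_equal; ring]. Qed.

Lemma KofR_mul (a b : R) : KofR k (a * b) = KofR k a * KofR k b.
Proof. destruct k; simpl; [reflexivity | f_equal; ring]. Qed.

Lemma KofR_opp (a : R) : KofR k (- a) = - KofR k a.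
Proof. destruct k; simpl; [reflexivity | f_equal; ring]. Qed.

Lemma KofR_inj (a b : R) : KofR k a = KofR k b -> a = b.
Proof. destruct k; simpl; [trivial | now intros [=]]. Qed.

Lemma Kinv_ex (x : K) : x <> 0 -> exists y, x * y = 1.
Proof.
  destruct k; simpl; intros H.
  - exists (/ x)%R; now apply Rinv_r.
  - exists (/ x)%C. exact (Cinv_r x H).
Qed.

Lemma Kmul_eq0 (x y : K) : x * y = 0 -> x = 0 \/ y = 0.
Proof.
  intros H; apply (f_equal (Knorm k)) in H.
  rewrite Knorm_mul, Knorm0 in H.
  apply Rmult_integral in H; destruct H; [left | right]; now apply Knorm_eq0.
Qed.

Lemma Ksub_eq0 (x y : K) : x - y = 0 -> x = y.
Proof. intros H; replace x with (x - y + y) by ring; rewrite H; ring. Qed.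

Lemma KofR_neq0 (a : R) : a <> 0%R -> KofR k a <> 0.
Proof. intros H H'; apply H, KofR_inj, H'. Qed.

(** * Derivatives and polynomial functions of one variable *)

Lemma ball_in (x a : K) r : norm (x - a) < r ->
  exists d, 0 < d /\ forall h, norm h < d -> norm (x + h - a) < r.
Proof.
  intros H; exists (r - norm (x - a))%R; split; [lra |]; intros h Hh.
  replace (x + h - a) with (x - a + h) by ring.
  pose proof (Knorm_triang (x - a) h); lra.
Qed.

(** Besides locality, the derivative value may change by an equation, so that the output of the
    product and sum rules can be normalised by [ring]. *)
Lemma hasderiv_ext (g g1 : K -> K) x l l1 d : 0 < d ->
  (forall h, norm h < d -> g (x + h) = g1 (x + h)) -> l = l1 ->
  hasderiv k g x l -> hasderiv k g1 x l1.
Proof.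
  intros Hd He <- H eps Heps. destruct (H eps Heps) as (d' & Hd' & H').
  exists (Rmin d d'); split; [now apply Rmin_pos |]. intros h Hh.
  pose proof (Rmin_l d d'); pose proof (Rmin_r d d').
  rewrite <- He by lra. replace (g1 x) with (g x); [apply H'; lra |].
  replace x with (x + 0) by ring. apply He. rewrite Knorm0; lra.
Qed.

Lemma hasderiv_unique (g : K -> K) x l l1 :
  hasderiv k g x l -> hasderiv k g x l1 -> l = l1.
Proof.
  intros H H1. apply Ksub_eq0, Knorm_eq0.
  destruct (Req_dec (norm (l - l1)) 0) as [| n]; [assumption |].
  pose proof (Knorm_pos (l - l1)).
  (* With this tolerance the two estimates at a small real increment e add up to |l - l1| e <= |l -
     l1| e / 2. *)
  assert (He : 0 < norm (l - l1) / 4) by lra.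
  destruct (H _ He) as (d & Hd & H'), (H1 _ He) as (d1 & Hd1 & H1').
  set (e := (Rmin d d1 / 2)%R).
  pose proof (Rmin_l d d1); pose proof (Rmin_r d d1); pose proof (Rmin_pos d d1 Hd Hd1).
  assert (Hn : norm (KofR k e) = e) by (rewrite Knorm_KofR; apply Rabs_pos_eq; unfold e; lra).
  assert (He1 : norm (KofR k e) < d) by (rewrite Hn; unfold e; lra).
  assert (He2 : norm (KofR k e) < d1) by (rewrite Hn; unfold e; lra).
  specialize (H' _ He1). specialize (H1' _ He2). rewrite Hn in H', H1'.
  set (u := g (x + KofR k e) - g x) in *.
  pose proof (Knorm_sub_triang (u - l1 * KofR k e) (u - l * KofR k e)) as Ht.
  replace (u - l1 * KofR k e - (u - l * KofR k e)) with ((l - l1) * KofR k e) in Ht by ring.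
  rewrite Knorm_mul, Hn in Ht.
  assert (0 < e) by (unfold e; lra). nra.
Qed.

Lemma hasderiv_const (a x : K) : hasderiv k (fun _ => a) x 0.
Proof.
  intros eps He; exists 1%R; split; [lra |]; intros h _.
  replace (a - a - 0 * h) with (0 : K) by ring. rewrite Knorm0.
  pose proof (Knorm_pos h); nra.
Qed.

Lemma hasderiv_id (x : K) : hasderiv k (fun t => t) x 1.
Proof.
  intros eps He; exists 1%R; split; [lra |]; intros h _.
  replace (x + h - x - 1 * h) with (0 : K) by ring. rewrite Knorm0.
  pose proof (Knorm_pos h); nra.
Qed.

Lemma hasderiv_add (f g : K -> K) x l m :
  hasderiv k f x l -> hasderiv k g x m -> hasderiv k (fun t => f t + g t) x (l + m).
Proof.
  intros Hf Hg eps He.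
  destruct (Hf (eps / 2)%R ltac:(lra)) as (d & Hd & H), (Hg (eps / 2)%R ltac:(lra)) as (d' & Hd' & H').
  exists (Rmin d d'); split; [now apply Rmin_pos |]; intros h Hh.
  pose proof (Rmin_l d d'); pose proof (Rmin_r d d').
  specialize (H h ltac:(lra)). specialize (H' h ltac:(lra)).
  replace (f (x + h) + g (x + h) - (f x + g x) - (l + m) * h)
    with (f (x + h) - f x - l * h + (g (x + h) - g x - m * h)) by ring.
  eapply Rle_trans; [apply Knorm_triang |]. lra.
Qed.

Lemma hasderiv_lip (f : K -> K) x l : hasderiv k f x l ->
  exists d, 0 < d /\ forall h, norm h < d -> norm (f (x + h) - f x) <= (norm l + 1) * norm h.
Proof.
  intros H; destruct (H 1%R ltac:(lra)) as (d & Hd & H1).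
  exists d; split; [assumption |]; intros h Hh; specialize (H1 h Hh).
  replace (f (x + h) - f x) with (f (x + h) - f x - l * h + l * h) by ring.
  eapply Rle_trans; [apply Knorm_triang |]. rewrite Knorm_mul; lra.
Qed.

Lemma hasderiv_mul (f g : K -> K) x l m :
  hasderiv k f x l -> hasderiv k g x m ->
  hasderiv k (fun t => f t * g t) x (l * g x + f x * m).
Proof.
  intros Hf Hg eps He.
  destruct (hasderiv_lip f x l Hf) as (d1 & Hd1 & H1).
  destruct (hasderiv_lip g x m Hg) as (d2 & Hd2 & H2).
  pose proof (Knorm_pos (g x)) as Pg; pose proof (Knorm_pos (f x)) as Pf.
  pose proof (Knorm_pos l) as Pl; pose proof (Knorm_pos m) as Pm.
  (* [A] bounds the two terms that are linear in the errors, [B] the product of the two increments,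
     which is of second order in h; each group receives eps / 2. *)
  set (A := (norm (g x) + norm (f x) + 1)%R).
  assert (HA : 0 < eps / (2 * A)) by (apply Rdiv_lt_0_compat; unfold A; lra).
  destruct (Hf _ HA) as (d3 & Hd3 & H3), (Hg _ HA) as (d4 & Hd4 & H4).
  set (B := ((norm l + 1) * (norm m + 1))%R).
  assert (HB0 : 0 < B) by (unfold B; nra).
  set (d5 := (eps / (2 * B))%R).
  assert (Hd5 : 0 < d5) by (apply Rdiv_lt_0_compat; lra).
  exists (Rmin (Rmin d1 d2) (Rmin (Rmin d3 d4) d5)); split.
  { repeat apply Rmin_pos; assumption. }
  intros h Hh.
  pose proof (Rmin_l (Rmin d1 d2) (Rmin (Rmin d3 d4) d5)).
  pose proof (Rmin_r (Rmin d1 d2) (Rmin (Rmin d3 d4) d5)).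
  pose proof (Rmin_l d1 d2); pose proof (Rmin_r d1 d2).
  pose proof (Rmin_l (Rmin d3 d4) d5); pose proof (Rmin_r (Rmin d3 d4) d5).
  pose proof (Rmin_l d3 d4); pose proof (Rmin_r d3 d4).
  specialize (H1 h ltac:(lra)); specialize (H2 h ltac:(lra)).
  specialize (H3 h ltac:(lra)); specialize (H4 h ltac:(lra)).
  set (u := f (x + h) - f x) in *; set (v := g (x + h) - g x) in *.
  replace (f (x + h) * g (x + h) - f x * g x - (l * g x + f x * m) * h)
    with ((u - l * h) * g x + f x * (v - m * h) + u * v) by (unfold u, v; ring).
  eapply Rle_trans; [apply Knorm_triang |].
  eapply Rle_trans; [apply Rplus_le_compat_r, Knorm_triang |].
  rewrite !Knorm_mul. pose proof (Knorm_pos h) as Ph.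
  pose proof (Knorm_pos u) as Pu; pose proof (Knorm_pos v) as Pv.
  set (e := (eps / (2 * A))%R) in *.
  assert (HAe : (A * e = eps / 2)%R) by (unfold e; field; unfold A; lra).
  assert (HBe : (B * d5 = eps / 2)%R) by (unfold d5; field; lra).
  assert (norm (u - l * h) * norm (g x) <= e * norm h * norm (g x))%R by (apply Rmult_le_compat_r; assumption).
  assert (norm (f x) * norm (v - m * h) <= norm (f x) * (e * norm h))%R by (apply Rmult_le_compat_l; assumption).
  assert (norm u * norm v <= (norm l + 1) * norm h * ((norm m + 1) * norm h))%R by (apply Rmult_le_compat; assumption).
  assert (B * norm h * norm h <= B * d5 * norm h)%R.
  { apply Rmult_le_compat_r; [assumption |]. apply Rmult_le_compat_l; lra. }
  assert (e * norm h * norm (g x) + norm (f x) * (e * norm h) <= eps / 2 * norm h)%R.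
  { rewrite <- HAe. unfold A. assert (0 <= e * norm h)%R by (apply Rmult_le_pos; lra). nra. }
  rewrite HBe in *. unfold B in *. lra.
Qed.

Lemma hasderiv_scal (a : K) (g : K -> K) x m :
  hasderiv k g x m -> hasderiv k (fun t => a * g t) x (a * m).
Proof.
  intros H; generalize (hasderiv_mul (fun _ => a) g x 0 m (hasderiv_const a x) H).
  apply (hasderiv_ext _ _ _ _ _ _ Rlt_0_1); intros; ring.
Qed.

Lemma hasderiv_sub (f g : K -> K) x l m :
  hasderiv k f x l -> hasderiv k g x m -> hasderiv k (fun t => f t - g t) x (l - m).
Proof.
  intros Hf Hg.
  generalize (hasderiv_add f _ x l _ Hf (hasderiv_scal (0 - 1) g x m Hg)).
  apply (hasderiv_ext _ _ _ _ _ _ Rlt_0_1); intros; ring.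
Qed.

Lemma hasderiv_cont (g : K -> K) x l : hasderiv k g x l -> Kcont_at k g x.
Proof.
  intros H eps He; destruct (hasderiv_lip g x l H) as (d & Hd & H1).
  pose proof (Knorm_pos l).
  assert (He' : 0 < eps / (norm l + 1)) by (apply Rdiv_lt_0_compat; lra).
  exists (Rmin d (eps / (norm l + 1))); split; [now apply Rmin_pos |].
  intros y Hy. pose proof (Rmin_l d (eps / (norm l + 1))); pose proof (Rmin_r d (eps / (norm l + 1))).
  specialize (H1 (y - x) ltac:(lra)).
  replace (x + (y - x)) with y in H1 by ring.
  eapply Rle_lt_trans; [exact H1 |].
  apply Rlt_le_trans with ((norm l + 1) * (eps / (norm l + 1)))%R.
  - apply Rmult_lt_compat_l; lra.
  - right; field; lra.
Qed.

(** All vector fields that have to be exhibited are polynomial on each branch. This class is closed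
    under derivatives, so its members are smooth at every point without a general calculus of smooth
    germs. *)
Inductive poly1 : (K -> K) -> Prop :=
| poly1_const a : poly1 (fun _ => a)
| poly1_id : poly1 (fun x => x)
| poly1_add f g : poly1 f -> poly1 g -> poly1 (fun x => f x + g x)
| poly1_mul f g : poly1 f -> poly1 g -> poly1 (fun x => f x * g x).

Lemma poly1_ext f g : poly1 f -> (forall x, f x = g x) -> poly1 g.
Proof. intros H E; apply functional_extensionality in E; now subst. Qed.

Lemma poly1_sub f g : poly1 f -> poly1 g -> poly1 (fun x => f x - g x).
Proof.
  intros Hf Hg. apply (poly1_ext (fun x => f x + (0 - 1) * g x)); [| intros; ring].
  apply poly1_add; [assumption |]. apply poly1_mul; [constructor | assumption].
Qed.

Lemma poly1_comp f g : poly1 f -> poly1 g -> poly1 (fun x => f (g x)).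
Proof.
  intros Hf Hg; induction Hf.
  - exact (poly1_const a).
  - exact Hg.
  - exact (poly1_add _ _ IHHf1 IHHf2).
  - exact (poly1_mul _ _ IHHf1 IHHf2).
Qed.

Lemma poly1_pow f n : poly1 f -> poly1 (fun x => f x ^ n).
Proof.
  intros Hf; induction n; simpl; [constructor |].
  exact (poly1_mul _ _ Hf IHn).
Qed.

Lemma poly1_deriv f : poly1 f -> exists f', poly1 f' /\ forall x, hasderiv k f x (f' x).
Proof.
  intros H; induction H as [a | | f g Hf (f' & Pf & Df) Hg (g' & Pg & Dg)
                            | f g Hf (f' & Pf & Df) Hg (g' & Pg & Dg)].
  - exists (fun _ => 0); split; [constructor | intros; apply hasderiv_const].
  - exists (fun _ => 1); split; [constructor | intros; apply hasderiv_id].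
  - exists (fun x => f' x + g' x); split; [now constructor |].
    intros; now apply hasderiv_add.
  - exists (fun x => f' x * g x + f x * g' x); split; [repeat constructor; assumption |].
    intros; now apply hasderiv_mul.
Qed.

Lemma poly1_cont f x : poly1 f -> Kcont_at k f x.
Proof. intros H; destruct (poly1_deriv f H) as (f' & _ & D); eapply hasderiv_cont, D. Qed.

Lemma poly1_smooth a f : poly1 f -> smooth1 k a f.
Proof.
  intros H; exists 1%R; split; [lra |]. intros n; revert f H; induction n; intros f H.
  - exists f; split; [constructor | intros; now apply poly1_cont].
  - destruct (poly1_deriv f H) as (f' & P & D). destruct (IHn f' P) as (h & Hh & C).
    exists h; split; [| exact C]. econstructor; [intros; apply D | exact Hh].
Qed.

Lemma smooth1_cont a f : smooth1 k a f -> Kcont_at k f a.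
Proof.
  intros (r & Hr & H); destruct (H 0%nat) as (h & Hh & C). inversion Hh; subst.
  apply C. replace (a - a) with (0 : K) by ring; now rewrite Knorm0.
Qed.

(** * Binary forms *)

(** Homogeneous polynomials as functions, generated by multiplication with linear forms. The
    properties needed are compatible with these generators, so coefficients never appear. *)
Inductive form : nat -> (P2 k -> K) -> Prop :=
| form_const a : form 0 (fun _ => a)
| form_lin a b d F : form d F -> form (S d) (fun p => (a * fst p + b * snd p) * F p)
| form_add d F G : form d F -> form d G -> form d (fun p => F p + G p).

(** Forms of degree [d - 1], where the only form of degree [-1] is [0]. *)
Definition dform (d : nat) (F : P2 k -> K) : Prop :=
  match d with O => forall p, F p = 0 | S d' => form d' F end.

Lemma form_ext d F G : form d F -> (forall p, F p = G p) -> form d G.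
Proof. intros H E; apply functional_extensionality in E; now subst. Qed.

Lemma form_zero d : form d (fun _ => 0).
Proof.
  induction d; [constructor |].
  apply (form_ext (S d) (fun p => (0 * fst p + 0 * snd p) * 0)); [| intros; ring].
  exact (form_lin 0 0 d _ IHd).
Qed.

Lemma form_scal a d F : form d F -> form d (fun p => a * F p).
Proof.
  intros H; induction H as [c | b c d F H IH | d F G HF IHF HG IHG].
  - exact (form_const (a * c)).
  - apply (form_ext _ _ _ (form_lin b c d _ IH)); intros; ring.
  - apply (form_ext _ _ _ (form_add d _ _ IHF IHG)); intros; ring.
Qed.

Lemma form_comb a b d F G : form d F -> form d G -> form d (fun p => a * F p + b * G p).
Proof. intros HF HG; exact (form_add d _ _ (form_scal a d F HF) (form_scal b d G HG)). Qed.

Lemma dform_add d F G : dform d F -> dform d G -> dform d (fun p => F p + G p).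
Proof.
  destruct d; simpl; [| apply form_add].
  intros HF HG p; rewrite HF, HG; ring.
Qed.

Lemma dform_lin a b d F : dform d F -> form d (fun p => (a * fst p + b * snd p) * F p).
Proof.
  destruct d; simpl; [| apply form_lin].
  intros H; apply (form_ext 0 _ _ (form_const 0)); intros p; rewrite H; ring.
Qed.

Lemma form_homogeneous d F c x y : form d F -> F (c * x, c * y) = c ^ d * F (x, y).
Proof.
  intros H; induction H; simpl in *; [ring | rewrite IHform; ring |].
  rewrite IHform1, IHform2; ring.
Qed.

Definition partials (F Fx Fy : P2 k -> K) : Prop :=
  (forall p, pd2 k false F Fx p) /\ (forall p, pd2 k true F Fy p).

Lemma partials_unique F Fx Fy Fx' Fy' : partials F Fx Fy -> partials F Fx' Fy' ->
  (forall p, Fx p = Fx' p) /\ (forall p, Fy p = Fy' p).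
Proof.
  intros [Hx Hy] [Hx' Hy']; split; intros p.
  - exact (hasderiv_unique _ _ _ _ (Hx p) (Hx' p)).
  - exact (hasderiv_unique _ _ _ _ (Hy p) (Hy' p)).
Qed.

Lemma partials_add F Fx Fy G Gx Gy : partials F Fx Fy -> partials G Gx Gy ->
  partials (fun p => F p + G p) (fun p => Fx p + Gx p) (fun p => Fy p + Gy p).
Proof.
  intros [Hx Hy] [Hx' Hy']; split; intros p.
  - exact (hasderiv_add _ _ _ _ _ (Hx p) (Hx' p)).
  - exact (hasderiv_add _ _ _ _ _ (Hy p) (Hy' p)).
Qed.

Lemma partials_scal a F Fx Fy : partials F Fx Fy ->
  partials (fun p => a * F p) (fun p => a * Fx p) (fun p => a * Fy p).
Proof.
  intros [Hx Hy]; split; intros p.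
  - exact (hasderiv_scal _ _ _ _ (Hx p)).
  - exact (hasderiv_scal _ _ _ _ (Hy p)).
Qed.

Lemma partials_ext F G Fx Fy : partials F Fx Fy -> (forall p, F p = G p) -> partials G Fx Fy.
Proof. intros H E; apply functional_extensionality in E; now subst. Qed.

(** The claims are bundled because the induction produces the partial derivatives only
    existentially; uniqueness then transfers each claim to arbitrary partials. The last clause is
    the Taylor expansion along the line v + t w with polynomial remainder; [g] is chosen before v
    and w, so that one [g] serves all branches. *)
Lemma form_partials_aux d F : form d F -> exists Fx Fy,
  dform d Fx /\ dform d Fy /\ partials F Fx Fy /\
  (forall p, fst p * Fx p + snd p * Fy p = KofR k (INR d) * F p) /\
  (exists g : K -> K -> K -> K -> K -> K, forall v1 v2 w1 w2,
     poly1 (g v1 v2 w1 w2) /\ forall t, F (v1 + t * w1, v2 + t * w2)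
     = F (v1, v2) + t * (w1 * Fx (v1, v2) + w2 * Fy (v1, v2)) + t * t * g v1 v2 w1 w2 t).
Proof.
  intros H; induction H as [a | a b d F H (Fx & Fy & Hx & Hy & [Px Py] & E & g & L)
    | d F G HF (Fx & Fy & Hx & Hy & PF & E & g & L) HG (Gx & Gy & Hx' & Hy' & PG & E' & g' & L')].
  - exists (fun _ => 0), (fun _ => 0); simpl.
    repeat split; try reflexivity; try (intros p; exact (hasderiv_const _ _)).
    + intros; ring.
    + exists (fun _ _ _ _ _ => 0); intros; split; [constructor | intros; ring].
  - exists (fun p => a * F p + (a * fst p + b * snd p) * Fx p),
           (fun p => b * F p + (a * fst p + b * snd p) * Fy p).
    repeat split.
    + exact (form_add d _ _ (form_scal a d F H) (dform_lin a b d Fx Hx)).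
    + exact (form_add d _ _ (form_scal b d F H) (dform_lin a b d Fy Hy)).
    + intros p. generalize (hasderiv_mul _ _ _ _ _
        (hasderiv_add _ _ _ _ _ (hasderiv_scal a _ _ _ (hasderiv_id (fst p)))
          (hasderiv_const (b * snd p) (fst p))) (Px p)).
      apply (hasderiv_ext _ _ _ _ _ _ Rlt_0_1); intros; simpl; destruct p; simpl; ring.
    + intros p. generalize (hasderiv_mul _ _ _ _ _
        (hasderiv_add _ _ _ _ _ (hasderiv_const (a * fst p) (snd p))
          (hasderiv_scal b _ _ _ (hasderiv_id (snd p)))) (Py p)).
      apply (hasderiv_ext _ _ _ _ _ _ Rlt_0_1); intros; simpl; destruct p; simpl; ring.
    + intros p. rewrite S_INR, KofR_add.
      replace (fst p * (a * F p + (a * fst p + b * snd p) * Fx p)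
               + snd p * (b * F p + (a * fst p + b * snd p) * Fy p))
        with ((a * fst p + b * snd p) * (fst p * Fx p + snd p * Fy p)
              + (a * fst p + b * snd p) * F p) by ring.
      rewrite E; ring.
    (* The coefficient of t^2 when the linear form at v + t w is multiplied by the expansion of
       [F]. *)
    + exists (fun v1 v2 w1 w2 t => (a * w1 + b * w2) * (w1 * Fx (v1, v2) + w2 * Fy (v1, v2))
                + ((a * v1 + b * v2) + t * (a * w1 + b * w2)) * g v1 v2 w1 w2 t).
      intros v1 v2 w1 w2; destruct (L v1 v2 w1 w2) as (Pg & Hg). split; [repeat (assumption || constructor) |].
      intros t; rewrite Hg; simpl; ring.
  - exists (fun p => Fx p + Gx p), (fun p => Fy p + Gy p).
    split; [now apply dform_add |]. split; [now apply dform_add |].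
    split; [now apply partials_add |]. split.
    + intros p. replace (fst p * (Fx p + Gx p) + snd p * (Fy p + Gy p))
        with ((fst p * Fx p + snd p * Fy p) + (fst p * Gx p + snd p * Gy p)) by ring.
      rewrite E, E'; ring.
    + exists (fun v1 v2 w1 w2 t => g v1 v2 w1 w2 t + g' v1 v2 w1 w2 t).
      intros v1 v2 w1 w2; destruct (L v1 v2 w1 w2) as (Pg & Hg).
      destruct (L' v1 v2 w1 w2) as (Pg' & Hg').
      split; [now constructor |]. intros t; rewrite Hg, Hg'; ring.
Qed.

Lemma form_partials d F : form d F -> exists Fx Fy,
  dform d Fx /\ dform d Fy /\ partials F Fx Fy.
Proof. intros H; destruct (form_partials_aux d F H) as (Fx & Fy & ? & ? & ? & _); eauto. Qed.

Lemma form_euler d F Fx Fy p : form d F -> partials F Fx Fy ->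
  fst p * Fx p + snd p * Fy p = KofR k (INR d) * F p.
Proof.
  intros H P; destruct (form_partials_aux d F H) as (Gx & Gy & _ & _ & P' & E & _).
  destruct (partials_unique _ _ _ _ _ P P') as [-> ->]. apply E.
Qed.

Lemma form_line d F Fx Fy : form d F -> partials F Fx Fy ->
  exists g : K -> K -> K -> K -> K -> K, forall v1 v2 w1 w2,
     poly1 (g v1 v2 w1 w2) /\ forall t, F (v1 + t * w1, v2 + t * w2)
     = F (v1, v2) + t * (w1 * Fx (v1, v2) + w2 * Fy (v1, v2)) + t * t * g v1 v2 w1 w2 t.
Proof.
  intros H P; destruct (form_partials_aux d F H) as (Gx & Gy & _ & _ & P' & _ & L).
  destruct (partials_unique _ _ _ _ _ P P') as [Ex Ey].
  apply functional_extensionality in Ex, Ey; now subst.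
Qed.

Lemma partials_form d F Fx Fy : form (S d) F -> partials F Fx Fy -> form d Fx /\ form d Fy.
Proof.
  intros H P; destruct (form_partials (S d) F H) as (Gx & Gy & Hx & Hy & P').
  destruct (partials_unique _ _ _ _ _ P P') as [Ex Ey].
  split; [apply (form_ext d Gx) | apply (form_ext d Gy)]; intros; auto.
Qed.

Lemma form_poly1 d F f g : form d F -> poly1 f -> poly1 g -> poly1 (fun t => F (f t, g t)).
Proof.
  intros H Hf Hg; induction H; simpl; [constructor | |].
  - repeat (assumption || apply poly1_mul || apply poly1_add || apply poly1_const).
  - exact (poly1_add _ _ IHform1 IHform2).
Qed.

(** The power of a x + b y takes the value 1 at (a, b), so subtracting it with coefficient F(a, b)
    leaves a form vanishing at (a, b), which is divisible by the linear form a y - b x. *)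
Lemma form_factor a b d F : a * a + b * b = 1 -> form d F ->
  exists G, dform d G /\ forall p,
    F p = (a * fst p + b * snd p) ^ d * F (a, b) + (a * snd p - b * fst p) * G p.
Proof.
  intros Hv H; induction H as [c | c e d F H (G & HG & E)
    | d F F' H (G & HG & E) H' (G' & HG' & E')].
  - exists (fun _ => 0); split; [now intros p | intros; simpl; ring].
  - exists (fun p => (a * e - b * c) * ((a * fst p + b * snd p) ^ d * F (a, b))
               + (c * fst p + e * snd p) * G p).
    split.
    + apply (form_add d).
      * assert (Hp : forall n, form n (fun p => (a * fst p + b * snd p) ^ n)).
        { induction n; [exact (form_const 1) | exact (form_lin a b n _ IHn)]. }
        apply (form_ext d (fun p => ((a * e - b * c) * F (a, b)) * (a * fst p + b * snd p) ^ d));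
          [apply form_scal, Hp | intros; ring].
      * now apply dform_lin.
    + intros p; rewrite (E p); simpl.
      set (T := (a * fst p + b * snd p) ^ d).
      (* The linear form in the coordinates along (a, b) and its quarter turn; this is where the
         unit length of (a, b) enters. *)
      assert (Hl : c * fst p + e * snd p = (c * a + e * b) * (a * fst p + b * snd p)
                 + (a * e - b * c) * (a * snd p - b * fst p)).
      { transitivity ((a * a + b * b) * (c * fst p + e * snd p)); [rewrite Hv |]; ring. }
      transitivity ((c * fst p + e * snd p) * (T * F (a, b))
        + (a * snd p - b * fst p) * ((c * fst p + e * snd p) * G p)); [ring |].
      rewrite Hl at 1; ring.
  - exists (fun p => G p + G' p); split; [now apply dform_add |].
    intros p; rewrite (E p), (E' p) at 1; ring.
Qed.

(** Splitting off the linear factor of the last line leaves a form of degree one less. That factor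
    is nonzero at the other points, so the quotient vanishes there and the induction continues. *)
Lemma form_eq0_of_zeros (va vb : nat -> K) d F :
  (forall j, (j <= d)%nat -> va j * va j + vb j * vb j = 1) ->
  (forall j l, (j <= d)%nat -> (l <= d)%nat -> j <> l -> va l * vb j - vb l * va j <> 0) ->
  form d F -> (forall j, (j <= d)%nat -> F (va j, vb j) = 0) -> forall p, F p = 0.
Proof.
  revert F; induction d; intros F Hv Hd HF H0 p;
    destruct (form_factor _ _ _ F (Hv _ (Nat.le_refl _)) HF) as (G & HG & E);
    rewrite E, (H0 _ (Nat.le_refl _)).
  - rewrite HG; ring.
  - rewrite (IHd G); [ring | | | exact HG |]; intros; auto.
    specialize (E (va j, vb j)). rewrite (H0 j), (H0 (S d)) in E by lia.
    destruct (Kmul_eq0 (va (S d) * vb j - vb (S d) * va j) (G (va j, vb j))) as [C |];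
      [| | assumption].
    + symmetry; etransitivity; [exact E | simpl; ring].
    + exfalso; revert C; apply Hd; lia.
Qed.

(** * Vector-valued forms and the operator [psi] *)

Definition vform (d : nat) (P : P2 k -> P2 k) : Prop :=
  form d (fun p => fst (P p)) /\ form d (fun p => snd (P p)).

(** The form N of the overview. *)
Definition cross (P : P2 k -> P2 k) (p : P2 k) : K :=
  fst p * snd (P p) - snd p * fst (P p).

(** A relation rather than a function, because derivatives are themselves given by a relation;
    existence and uniqueness of the value are separate lemmas. *)
Definition psi (P G : P2 k -> P2 k) : Prop :=
  exists Nx Ny, partials (cross P) Nx Ny /\
    forall p, G p = (fst (P p) - (1 + 1) * Ny p, snd (P p) + (1 + 1) * Nx p).

Lemma form_cross d P : vform d P -> form (S d) (cross P).
Proof.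
  intros [H1 H2].
  apply (form_ext (S d) (fun p => (1 * fst p + 0 * snd p) * snd (P p)
                       + (0 * fst p + (0 - 1) * snd p) * fst (P p))).
  - apply form_add; [exact (form_lin 1 0 d _ H2) | exact (form_lin 0 (0 - 1) d _ H1)].
  - intros p; unfold cross; ring.
Qed.

Lemma psi_form d P G : vform d P -> psi P G -> vform d G.
Proof.
  intros HP (Nx & Ny & HN & HG).
  destruct (partials_form d _ _ _ (form_cross d P HP) HN) as [Fx Fy].
  destruct HP as [H1 H2]; split.
  - apply (form_ext _ _ _ (form_comb 1 (0 - (1 + 1)) d _ _ H1 Fy)).
    intros p; rewrite HG; simpl; ring.
  - apply (form_ext _ _ _ (form_comb 1 (1 + 1) d _ _ H2 Fx)).
    intros p; rewrite HG; simpl; ring.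
Qed.

Lemma psi_exists d P : vform d P -> exists G, psi P G.
Proof.
  intros HP; destruct (form_partials _ _ (form_cross d P HP)) as (Nx & Ny & _ & _ & HN).
  eexists; exists Nx, Ny; split; [exact HN | reflexivity].
Qed.

Lemma psi_unique P P' G G' p : psi P G -> psi P' G' -> (forall p, P p = P' p) -> G p = G' p.
Proof.
  intros (Nx & Ny & HN & HG) (Nx' & Ny' & HN' & HG') E.
  apply functional_extensionality in E; subst P'.
  destruct (partials_unique _ _ _ _ _ HN HN') as [Ex Ey].
  now rewrite HG, HG', Ex, Ey.
Qed.

Lemma psi_comb a b P G P' G' : psi P G -> psi P' G' ->
  psi (fun p => P2add k (P2scale k a (P p)) (P2scale k b (P' p)))
      (fun p => P2add k (P2scale k a (G p)) (P2scale k b (G' p))).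
Proof.
  intros (Nx & Ny & HN & HG) (Nx' & Ny' & HN' & HG').
  exists (fun p => a * Nx p + b * Nx' p), (fun p => a * Ny p + b * Ny' p); split.
  - apply (partials_ext _ _ _ _
      (partials_add _ _ _ _ _ _ (partials_scal a _ _ _ HN) (partials_scal b _ _ _ HN'))).
    intros p; unfold cross; simpl; ring.
  - intros p; rewrite HG, HG'; unfold P2add, P2scale; simpl; f_equal; ring.
Qed.

(** The integer 2d + 3; the summand 2(d + 1) comes from Euler's identity for N, whose degree is d +
    1. *)
Definition psi_const (d : nat) : K := 1 + (1 + 1) * KofR k (INR (S d)).

Lemma psi_const_neq0 d : psi_const d <> 0.
Proof.
  unfold psi_const; rewrite <- !KofR_add, <- KofR_mul, <- KofR_add.
  apply KofR_neq0. pose proof (pos_INR (S d)); lra.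
Qed.

(** The correction term of [psi] contributes 2 (x dN/dx + y dN/dy) to the cross product, which
    Euler's identity turns into a multiple of N. *)
Lemma psi_cross d P G p : vform d P -> psi P G -> cross G p = psi_const d * cross P p.
Proof.
  intros HP (Nx & Ny & HN & HG).
  pose proof (form_euler _ _ _ _ p (form_cross d P HP) HN) as E.
  unfold psi_const; transitivity (cross P p + (1 + 1) * (KofR k (INR (S d)) * cross P p)); [| ring].
  rewrite <- E; unfold cross; rewrite HG; simpl; ring.
Qed.

(** If psi P = 0 then N = 0 by [psi_cross], so the derivatives of N vanish as well and P = psi P. *)
Lemma psi_injective d P G : vform d P -> psi P G -> (forall p, G p = P2zero k) ->
  forall p, P p = P2zero k.
Proof.
  intros HP H H0 p.
  assert (E : forall q, 0 = cross P q).
  { intros q; pose proof (psi_cross d P G q HP H) as E. unfold cross at 1 in E.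
    rewrite H0 in E; simpl in E.
    destruct (Kmul_eq0 (psi_const d) (cross P q)) as [C | ->]; [| | reflexivity].
    - rewrite <- E; ring.
    - now apply psi_const_neq0 in C. }
  destruct H as (Nx & Ny & HN & HG).
  assert (H0' : partials (fun _ : P2 k => 0) (fun _ => 0) (fun _ => 0)).
  { split; intros q; exact (hasderiv_const _ _). }
  destruct (partials_unique _ _ _ _ _ HN (partials_ext _ _ _ _ H0' E)) as [Ex Ey].
  specialize (HG p); rewrite H0, Ex, Ey in HG; unfold P2zero in *.
  injection HG; intros E2 E1.
  rewrite (surjective_pairing (P p)); f_equal; [rewrite E1 | rewrite E2]; ring.
Qed.

Lemma psi_surjective d G : vform d G -> exists P, vform d P /\ psi P G.
Proof.
  intros HG; destruct (Kinv_ex _ (psi_const_neq0 d)) as (e & He).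
  pose proof (form_cross d G HG) as HM.
  destruct (form_partials _ _ HM) as (Mx & My & Fx & Fy & HP).
  pose proof (fun p => form_euler _ _ _ _ p HM HP) as E.
  (* With M the cross product of [G], the cross product of the preimage must be e M by [psi_cross];
     solving psi P = G for P with N = e M gives this formula. *)
  exists (fun p => (fst (G p) + (1 + 1) * e * My p, snd (G p) + (0 - (1 + 1) * e) * Mx p)).
  destruct HG as [H1 H2]. simpl in Fx, Fy. split.
  { split.
    - exact (form_add d _ _ H1 (form_scal _ d _ Fy)).
    - exact (form_add d _ _ H2 (form_scal _ d _ Fx)). }
  exists (fun p => e * Mx p), (fun p => e * My p); split.
  - apply (partials_ext _ _ _ _ (partials_scal e _ _ _ HP)); intros p.
    transitivity (cross G p - (1 + 1) * e * (fst p * Mx p + snd p * My p));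
      [| unfold cross; simpl; ring].
    rewrite E. transitivity (psi_const d * e * cross G p
       - (1 + 1) * e * (KofR k (INR (S d)) * cross G p)); [unfold psi_const; ring |].
    rewrite He; ring.
  - intros p; rewrite (surjective_pairing (G p)) at 1; simpl; f_equal; ring.
Qed.

(** A vector is zero iff its components along v = (a, b) and along the quarter turn of v are. For
    psi P at v the second component is (2d + 3) N(v), the first is <P(v), v> - 2 dN(v)(w). *)
Lemma psi_eq0_iff d P G Nx Ny a b : a * a + b * b = 1 -> vform d P ->
  partials (cross P) Nx Ny ->
  (forall p, G p = (fst (P p) - (1 + 1) * Ny p, snd (P p) + (1 + 1) * Nx p)) ->
  G (a, b) = P2zero k <->
  cross P (a, b) = 0 /\
  (1 + 1) * (a * Ny (a, b) - b * Nx (a, b)) = a * fst (P (a, b)) + b * snd (P (a, b)).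
Proof.
  intros Hv HP HN HG.
  assert (HC := psi_cross d P G (a, b) HP (ex_intro _ Nx (ex_intro _ Ny (conj HN HG)))).
  assert (HT : a * fst (G (a, b)) + b * snd (G (a, b))
    = a * fst (P (a, b)) + b * snd (P (a, b)) - (1 + 1) * (a * Ny (a, b) - b * Nx (a, b))).
  { rewrite HG; simpl; ring. }
  unfold cross in HC at 1; simpl in HC. split.
  - intros E; rewrite E in HC, HT; simpl in HC, HT; split.
    + destruct (Kmul_eq0 (psi_const d) (cross P (a, b))) as [C |]; [| | assumption].
      * rewrite <- HC; ring.
      * now apply psi_const_neq0 in C.
    + symmetry; apply Ksub_eq0; rewrite <- HT; ring.
  - intros [E1 E2]; rewrite E1 in HC; rewrite E2 in HT.
    set (g1 := fst (G (a, b))) in *; set (g2 := snd (G (a, b))) in *.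
    rewrite (surjective_pairing (G (a, b))); fold g1 g2; unfold P2zero; f_equal.
    + transitivity ((a * a + b * b) * g1); [rewrite Hv; ring |].
      transitivity (a * (a * g1 + b * g2) - b * (a * g2 - b * g1)); [ring |].
      rewrite HC, HT; ring.
    + transitivity ((a * a + b * b) * g2); [rewrite Hv; ring |].
      transitivity (b * (a * g1 + b * g2) + a * (a * g2 - b * g1)); [ring |].
      rewrite HC, HT; ring.
Qed.

(** * Finite choice and finite sums of vector-valued forms *)

(** Choice over finitely many indices by induction; [a0] only fills the values beyond the bound. *)
Lemma bounded_choice (A : Type) (a0 : A) (R : nat -> A -> Prop) n :
  (forall j, (j < n)%nat -> exists x, R j x) ->
  exists f, forall j, (j < n)%nat -> R j (f j).
Proof.
  induction n; intros H; [exists (fun _ => a0); intros; lia |].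
  destruct IHn as (f & Hf); [auto |]. destruct (H n) as (x & Hx); [lia |].
  exists (fun j => if Nat.eq_dec j n then x else f j); intros j Hj.
  destruct (Nat.eq_dec j n) as [-> |]; [exact Hx | apply Hf; lia].
Qed.

Lemma P2add_zero_l v : P2add k (P2zero k) v = v.
Proof. destruct v; unfold P2add, P2zero; simpl; f_equal; ring. Qed.

Lemma P2add_zero_r v : P2add k v (P2zero k) = v.
Proof. destruct v; unfold P2add, P2zero; simpl; f_equal; ring. Qed.

Lemma P2sub_zero_r v : P2sub k v (P2zero k) = v.
Proof. destruct v; unfold P2sub, P2zero; simpl; f_equal; ring. Qed.

Lemma P2sub_eq0 u v : P2sub k u v = P2zero k -> u = v.
Proof.
  destruct u, v; unfold P2sub, P2zero; simpl; intros [=]; f_equal; now apply Ksub_eq0.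
Qed.

Lemma P2sum_eq0 n F p : (forall j, (j < n)%nat -> F j p = P2zero k) -> P2sum k n F p = P2zero k.
Proof.
  induction n; intros H; simpl; [reflexivity |].
  rewrite IHn by auto. rewrite H by lia. apply P2add_zero_l.
Qed.

Lemma P2sum_single n F p m : (m < n)%nat ->
  (forall j, (j < n)%nat -> j <> m -> F j p = P2zero k) -> P2sum k n F p = F m p.
Proof.
  induction n; intros Hm H; simpl; [lia |].
  destruct (Nat.eq_dec m n) as [-> |].
  - rewrite P2sum_eq0; [apply P2add_zero_l |]. intros; apply H; lia.
  - rewrite IHn, (H n) by (auto || lia). apply P2add_zero_r.
Qed.

Lemma vform_add d P Q : vform d P -> vform d Q -> vform d (fun p => P2add k (P p) (Q p)).
Proof. intros [? ?] [? ?]; split; now apply (form_add d). Qed.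

Lemma vform_comb d a b P Q : vform d P -> vform d Q ->
  vform d (fun p => P2add k (P2scale k a (P p)) (P2scale k b (Q p))).
Proof. intros [? ?] [? ?]; split; now apply (form_comb a b d). Qed.

Lemma psi_add P G P' G' : psi P G -> psi P' G' ->
  psi (fun p => P2add k (P p) (P' p)) (fun p => P2add k (G p) (G' p)).
Proof.
  assert (E : forall u v, P2add k (P2scale k 1 u) (P2scale k 1 v) = P2add k u v).
  { intros; unfold P2add, P2scale; simpl; f_equal; ring. }
  intros H H'; generalize (psi_comb 1 1 _ _ _ _ H H').
  rewrite (functional_extensionality _ (fun p => P2add k (P p) (P' p)) (fun p => E _ _)).
  now rewrite (functional_extensionality _ (fun p => P2add k (G p) (G' p)) (fun p => E _ _)).
Qed.

Lemma psi_zero : psi (fun _ => P2zero k) (fun _ => P2zero k).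
Proof.
  exists (fun _ => 0), (fun _ => 0); split.
  - apply (partials_ext (fun _ => 0)); [| intros; unfold cross; simpl; ring].
    split; intros q; exact (hasderiv_const _ _).
  - intros; unfold P2zero; simpl; f_equal; ring.
Qed.

Lemma vform_sum d n Q : (forall j, (j < n)%nat -> vform d (Q j)) -> vform d (P2sum k n Q).
Proof.
  induction n; intros H; [split; apply form_zero |].
  apply (vform_add d (P2sum k n Q)); auto.
Qed.

Lemma psi_sum n Q H : (forall j, (j < n)%nat -> psi (Q j) (H j)) ->
  psi (P2sum k n Q) (P2sum k n H).
Proof.
  induction n; intros HQ; [exact psi_zero |].
  apply (psi_add (P2sum k n Q)); auto.
Qed.

(** * Interpolation at d + 1 independent lines *)

Section Lines.
Context (va vb : nat -> K) (d : nat)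
  (unit_v : forall j, (j <= d)%nat -> va j * va j + vb j * vb j = 1)
  (indep_v : forall j l, (j <= d)%nat -> (l <= d)%nat -> j <> l ->
     va l * vb j - vb l * va j <> 0).

Lemma lagrange_form j : (j <= d)%nat -> exists M, form d M /\ M (va j, vb j) = 1 /\
  forall m, (m <= d)%nat -> m <> j -> M (va m, vb m) = 0.
Proof.
  intros Hj.
  assert (HL : forall L, (forall m, In m L -> (m <= d)%nat /\ m <> j) ->
    exists M, form (length L) M /\ M (va j, vb j) <> 0 /\
      forall m, In m L -> M (va m, vb m) = 0).
  { induction L as [| l L IH]; intros HL.
    - exists (fun _ => 1); split; [exact (form_const 1) |]. split; [| intros m []].
      apply KofR_neq0; lra.
    - destruct IH as (M & HM & HMj & HMm); [intros; apply HL; now right |].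
      destruct (HL l (or_introl eq_refl)) as [Hl Hlj].
      (* One more linear factor, vanishing on the line [l] and, by independence, not at the point
         [j]. *)
      exists (fun p => ((0 - vb l) * fst p + va l * snd p) * M p).
      split; [exact (form_lin _ _ _ _ HM) |]. simpl. split.
      + intros C; apply Kmul_eq0 in C; destruct C as [C | C]; [| contradiction].
        apply (indep_v j l Hj Hl (not_eq_sym Hlj)). rewrite <- C; ring.
      + intros m [<- | Hm]; [ring | rewrite (HMm m Hm); ring]. }
  (* The indices up to [d] other than [j]: exactly [d] linear factors. *)
  destruct (HL (seq 0 j ++ seq (S j) (d - j))) as (M & HM & HMj & HMm).
  { intros m Hm; apply in_app_or in Hm; destruct Hm as [Hm | Hm]; apply in_seq in Hm; lia. }
  replace (length (seq 0 j ++ seq (S j) (d - j))) with d in HM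
    by (rewrite length_app, !length_seq; lia).
  destruct (Kinv_ex _ HMj) as (e & He).
  exists (fun p => e * M p); split; [now apply form_scal |]; split; [rewrite <- He; ring |].
  intros m Hm Hmj; rewrite HMm; [ring |].
  apply in_or_app; rewrite !in_seq. lia.
Qed.

Lemma vform_eq0_of_zeros P : vform d P ->
  (forall j, (j <= d)%nat -> P (va j, vb j) = P2zero k) -> forall p, P p = P2zero k.
Proof.
  intros [H1 H2] H0 p.
  rewrite (surjective_pairing (P p)); unfold P2zero; f_equal.
  - apply (form_eq0_of_zeros va vb d (fun p => fst (P p)) unit_v indep_v H1).
    intros; now rewrite H0.
  - apply (form_eq0_of_zeros va vb d (fun p => snd (P p)) unit_v indep_v H2).
    intros; now rewrite H0.
Qed.

(** With G = psi P, let Q_j be the preimage under psi of the Lagrange form M_j times the vector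
    G(v_j). Then psi(P - sum Q_j) has degree d and vanishes on d + 1 lines, so it is zero, and
    injectivity of psi gives P = sum Q_j. *)
Lemma vform_decomposition P : vform d P ->
  exists Q H : nat -> P2 k -> P2 k,
    (forall j, (j <= d)%nat -> vform d (Q j) /\ psi (Q j) (H j) /\
       forall m, (m <= d)%nat -> m <> j -> H j (va m, vb m) = P2zero k) /\
    forall p, P p = P2sum k (S d) Q p.
Proof.
  intros HP. destruct (psi_exists d P HP) as (G & HG).
  destruct (bounded_choice ((P2 k -> P2 k) * (P2 k -> P2 k))
    ((fun _ => P2zero k), (fun _ => P2zero k))
    (fun j QH => vform d (fst QH) /\ psi (fst QH) (snd QH) /\
       snd QH (va j, vb j) = G (va j, vb j) /\
       forall m, (m <= d)%nat -> m <> j -> snd QH (va m, vb m) = P2zero k) (S d)) as (f & Hf).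
  { intros j Hj. destruct (lagrange_form j) as (M & HM & HMj & HMm); [lia |].
    destruct (psi_surjective d (fun p => P2scale k (M p) (G (va j, vb j)))) as (Q & HQ & HQG).
    { split; simpl; [apply (form_ext d _ _ (form_scal (fst (G (va j, vb j))) d _ HM))
        | apply (form_ext d _ _ (form_scal (snd (G (va j, vb j))) d _ HM))]; intros; ring. }
    exists (Q, fun p => P2scale k (M p) (G (va j, vb j))); simpl.
    repeat split; try apply HQ; try assumption.
    - rewrite HMj, (surjective_pairing (G (va j, vb j))); unfold P2scale; simpl; f_equal; ring.
    - intros m Hm Hmj; rewrite HMm by assumption.
      unfold P2scale, P2zero; simpl; f_equal; ring. }
  exists (fun j => fst (f j)), (fun j => snd (f j)).
  assert (Hf' := fun j (Hj : (j <= d)%nat) => Hf j (proj2 (Nat.lt_succ_r j d) Hj)).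
  split.
  { intros j Hj; destruct (Hf' j Hj) as (? & ? & _ & ?); auto. }
  set (Q := fun j => fst (f j)); set (H := fun j => snd (f j)).
  assert (HS : vform d (P2sum k (S d) Q)) by (apply vform_sum; intros; now apply Hf).
  assert (HSG : psi (P2sum k (S d) Q) (P2sum k (S d) H)) by (apply psi_sum; intros; now apply Hf).
  assert (Hsub : forall u v, P2add k (P2scale k 1 u) (P2scale k (0 - 1) v) = P2sub k u v).
  { intros u v; unfold P2add, P2scale, P2sub; simpl; f_equal; ring. }
  assert (HD := vform_comb d 1 (0 - 1) _ _ HP HS).
  assert (HDG := psi_comb 1 (0 - 1) _ _ _ _ HG HSG).
  intros p; apply P2sub_eq0; rewrite <- Hsub.
  refine (psi_injective d _ _ HD HDG _ p).
  apply vform_eq0_of_zeros; [exact (psi_form d _ _ HD HDG) |].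
  intros m Hm.
  rewrite (P2sum_single (S d) H _ m); [| lia |].
  - replace (H m (va m, vb m)) with (G (va m, vb m)) by (symmetry; now apply Hf').
    unfold P2add, P2scale, P2zero; simpl; f_equal; ring.
  - intros j Hj Hjm; apply (Hf j Hj); auto.
Qed.

(** Applying psi to the sum and evaluating at v_j leaves only H_j(v_j), which is therefore zero. So
    H_j vanishes on all d + 1 lines, hence everywhere, and Q_j = 0 by injectivity. *)
Lemma vform_independence (Q H : nat -> P2 k -> P2 k) :
  (forall j, (j <= d)%nat -> vform d (Q j) /\ psi (Q j) (H j) /\
     forall m, (m <= d)%nat -> m <> j -> H j (va m, vb m) = P2zero k) ->
  (forall p, P2sum k (S d) Q p = P2zero k) ->
  forall j, (j <= d)%nat -> forall p, Q j p = P2zero k.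
Proof.
  intros HQ H0 j Hj. destruct (HQ j Hj) as (Fj & Pj & Zj).
  apply (psi_injective d _ (H j) Fj Pj).
  apply vform_eq0_of_zeros; [exact (psi_form d _ _ Fj Pj) |]. intros m Hm.
  destruct (Nat.eq_dec m j) as [-> |]; [| now apply Zj].
  rewrite <- (P2sum_single (S d) H (va j, vb j) j); [| lia |].
  - apply (psi_unique (P2sum k (S d) Q) (fun _ => P2zero k) _ (fun _ => P2zero k));
      [| exact psi_zero | exact H0].
    apply psi_sum; intros l Hl; apply HQ; lia.
  - intros l Hl Hlj; apply HQ; lia || auto.
Qed.

End Lines.

(** * Real components, the mean value inequality and symmetry of second derivatives *)

(** Real-linear maps of norm at most 1. They reduce statements about K-valued functions to real
    ones, uniformly in the field. *)
Definition component (pr : K -> R) : Prop :=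
  (forall x y, pr (x - y) = (pr x - pr y)%R) /\
  (forall x r, pr (KofR k r * x) = (r * pr x)%R) /\
  (forall x, Rabs (pr x) <= norm x).

Definition Kre : K -> R := match k return Kt k -> R with KR => fun x => x | KC => fst end.
Definition Kim : K -> R := match k return Kt k -> R with KR => fun _ => 0%R | KC => snd end.

Lemma component_Kre : component Kre.
Proof.
  unfold component, Kre; destruct k; repeat split; simpl; intros; try reflexivity; unfold Ksub; simpl; try ring.
  change (Rabs (fst x) <= Knorm KC x). rewrite Knorm_KC. exact (re_le_Cmod x).
Qed.

Lemma component_Kim : component Kim.
Proof.
  unfold component, Kim; destruct k; repeat split; simpl; intros; try reflexivity; unfold Ksub; simpl; try ring.
  - rewrite Rabs_R0; apply Rabs_pos.
  - change (Rabs (snd x) <= Knorm KC x). rewrite Knorm_KC. eapply Rle_trans; [apply Rmax_r | apply Rmax_Cmod].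
Qed.

Lemma Knorm_components (x : K) : norm x <= Rabs (Kre x) + Rabs (Kim x).
Proof.
  unfold Kre, Kim; destruct k; simpl; [rewrite Rabs_R0; lra |].
  replace (fst x * fst x + snd x * snd x)%R with (Rabs (fst x) ^ 2 + Rabs (snd x) ^ 2)%R
    by (rewrite !pow2_abs; ring).
  pose proof (Rabs_pos (fst x)); pose proof (Rabs_pos (snd x)).
  apply Rsqr_incr_0_var; [| lra]. rewrite Rsqr_sqrt by nra. unfold Rsqr; nra.
Qed.

Lemma Keq_components (x y : K) : Kre x = Kre y -> Kim x = Kim y -> x = y.
Proof. unfold Kre, Kim; destruct k; [auto |]. intros; now apply injective_projections. Qed.

Lemma is_derive_component pr (g : K -> K) x h s l : component pr ->
  hasderiv k g (x + KofR k s * h) l ->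
  is_derive (fun t => pr (g (x + KofR k t * h))) s (pr (l * h)).
Proof.
  intros (Psub & Pmul & Ple) H; apply is_derive_Reals. intros eps He.
  pose proof (Knorm_pos h) as Ph.
  assert (He' : 0 < eps / (2 * (norm h + 1))) by (apply Rdiv_lt_0_compat; lra).
  destruct (H _ He') as (d & Hd & H').
  assert (Hd' : 0 < d / (norm h + 1)) by (apply Rdiv_lt_0_compat; lra).
  exists (mkposreal _ Hd'); intros t Ht0 Ht; simpl in Ht.
  assert (Ht' : norm (KofR k t * h) < d).
  { rewrite Knorm_mul, Knorm_KofR.
    apply Rle_lt_trans with (Rabs t * (norm h + 1))%R; [pose proof (Rabs_pos t); nra |].
    replace d with (d / (norm h + 1) * (norm h + 1))%R by (field; lra).
    apply Rmult_lt_compat_r; lra. }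
  specialize (H' _ Ht').
  replace (x + KofR k s * h + KofR k t * h) with (x + KofR k (s + t) * h) in H'
    by (rewrite KofR_add; ring).
  replace (l * (KofR k t * h)) with (KofR k t * (l * h)) in H' by ring.
  rewrite Knorm_mul, Knorm_KofR in H'.
  pose proof (Rle_trans _ _ _ (Ple _) H') as Hle. rewrite !Psub, Pmul in Hle.
  set (D := (pr (g (x + KofR k (s + t) * h)%K) - pr (g (x + KofR k s * h)%K))%R) in *.
  assert (Pt : 0 < Rabs t) by now apply Rabs_pos_lt.
  replace (D / t - pr (l * h)%K)%R with ((D - t * pr (l * h)%K) / t)%R by now field.
  unfold Rdiv; rewrite Rabs_mult, Rabs_inv.
  apply Rmult_lt_reg_r with (Rabs t); [assumption |].
  rewrite Rmult_assoc, Rinv_l, Rmult_1_r by lra.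
  apply Rle_lt_trans with (eps / (2 * (norm h + 1)) * (Rabs t * norm h))%R; [assumption |].
  replace (eps / (2 * (norm h + 1)) * (Rabs t * norm h))%R
    with (eps * Rabs t * (norm h / (2 * (norm h + 1))))%R by (field; lra).
  assert (norm h / (2 * (norm h + 1)) < 1).
  { apply Rmult_lt_reg_r with (2 * (norm h + 1))%R; [lra |].
    unfold Rdiv; rewrite Rmult_assoc, Rinv_l by lra; lra. }
  assert (0 < eps * Rabs t) by (apply Rmult_lt_0_compat; lra). nra.
Qed.

(** The mean value theorem is applied to the real and the imaginary part of g on the segment
    separately; the factor 2 is the cost of adding the two bounds. *)
Lemma mean_value_inequality (g g' : K -> K) x h M :
  (forall t, 0 <= t <= 1 -> hasderiv k g (x + KofR k t * h) (g' (x + KofR k t * h)) /\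
     norm (g' (x + KofR k t * h)) <= M) ->
  norm (g (x + h) - g x) <= 2 * M * norm h.
Proof.
  intros H.
  assert (Hc : forall pr, component pr -> Rabs (pr (g (x + h) - g x)) <= M * norm h).
  { intros pr Hpr.
    destruct (MVT_cor2 (fun t => pr (g (x + KofR k t * h)))
      (fun t => pr (g' (x + KofR k t * h) * h)) 0 1 Rlt_0_1) as (c & Hc & Hc').
    { intros c Hc; apply is_derive_Reals, is_derive_component; [assumption | now apply H]. }
    destruct Hpr as (Psub & _ & Ple). rewrite Psub.
    replace (x + KofR k 1 * h) with (x + h) in Hc by ring.
    replace (x + 0 * h) with x in Hc by ring.
    rewrite Hc, Rminus_0_r, Rmult_1_r.
    eapply Rle_trans; [apply Ple |]. rewrite Knorm_mul.
    apply Rmult_le_compat_r; [apply Knorm_pos | apply H; lra]. }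
  eapply Rle_trans; [apply Knorm_components |].
  pose proof (Hc _ component_Kre); pose proof (Hc _ component_Kim); lra.
Qed.

Lemma ball2_open a r p : ball2 k a r p ->
  exists d, 0 < d /\ forall q, ball2 k p d q -> ball2 k a r q.
Proof.
  intros [H1 H2].
  destruct (ball_in _ _ _ H1) as (d1 & Hd1 & B1), (ball_in _ _ _ H2) as (d2 & Hd2 & B2).
  exists (Rmin d1 d2); split; [now apply Rmin_pos |]. intros q [Q1 Q2].
  pose proof (Rmin_l d1 d2); pose proof (Rmin_r d1 d2).
  specialize (B1 _ (Rlt_le_trans _ _ _ Q1 (Rmin_l d1 d2))).
  specialize (B2 _ (Rlt_le_trans _ _ _ Q2 (Rmin_r d1 d2))).
  replace (fst p + (fst q - fst p)) with (fst q) in B1 by ring.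
  replace (snd p + (snd q - snd p)) with (snd q) in B2 by ring.
  now split.
Qed.

Lemma ball2_center a r : 0 < r -> ball2 k a r a.
Proof.
  intros; split; [replace (fst a - fst a) with (0 : K) by ring
    | replace (snd a - snd a) with (0 : K) by ring]; now rewrite Knorm0.
Qed.

Lemma ball2_le a r r' p : ball2 k a r p -> r <= r' -> ball2 k a r' p.
Proof. intros [? ?] ?; split; lra. Qed.

(** Each component of g, restricted to the real translates p + (s, t), is a function of two real
    variables to which the real Schwarz theorem applies; this suffices over C too, as K-derivatives
    in real directions are the real derivatives. *)
Lemma schwarz_K a r g gx gy gxy gyx p : ball2 k a r p ->
  (forall q, ball2 k a r q -> pd2 k false g gx q /\ pd2 k true g gy q /\
     pd2 k true gx gxy q /\ pd2 k false gy gyx q /\ Kcont2_at k gxy q /\ Kcont2_at k gyx q) ->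
  gxy p = gyx p.
Proof.
  intros Hp H.
  assert (Hc : forall pr, component pr -> pr (gxy p) = pr (gyx p)).
  2:{ apply Keq_components; apply Hc; [apply component_Kre | apply component_Kim]. }
  intros pr Hpr. destruct p as [x y]. destruct (ball2_open _ _ _ Hp) as (d & Hd & Hb).
  (* The factors 1 match the shape x + s h of [is_derive_component], with direction h = 1. *)
  set (at_ := fun s t : R => (x + KofR k s * 1, y + KofR k t * 1) : P2 k).
  assert (Hat : forall s t, Rabs s < d -> Rabs t < d -> ball2 k a r (at_ s t)).
  { intros s t Hs Ht; apply Hb; split; unfold at_; simpl.
    - replace (x + KofR k s * 1 - x) with (KofR k s) by ring. now rewrite Knorm_KofR.
    - replace (y + KofR k t * 1 - y) with (KofR k t) by ring. now rewrite Knorm_KofR. }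
  assert (Hat0 : at_ 0%R 0%R = (x, y)) by (unfold at_; f_equal; ring).
  assert (D1 : forall F Fx s t, pd2 k false F Fx (at_ s t) ->
    is_derive (fun z => pr (F (at_ z t))) s (pr (Fx (at_ s t)))).
  { intros F Fx s t HF; unfold pd2, at_ in HF; simpl in HF.
    generalize (is_derive_component pr (fun z => F (z, y + KofR k t * 1)) _ _ _ _ Hpr HF).
    now replace (Fx (x + KofR k s * 1, y + KofR k t * 1) * 1) with (Fx (at_ s t))
      by (unfold at_; ring). }
  assert (D2 : forall F Fy s t, pd2 k true F Fy (at_ s t) ->
    is_derive (fun z => pr (F (at_ s z))) t (pr (Fy (at_ s t)))).
  { intros F Fy s t HF; unfold pd2, at_ in HF; simpl in HF.
    generalize (is_derive_component pr (fun z => F (x + KofR k s * 1, z)) _ _ _ _ Hpr HF).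
    now replace (Fy (x + KofR k s * 1, y + KofR k t * 1) * 1) with (Fy (at_ s t))
      by (unfold at_; ring). }
  (* [Schwarz] speaks of iterated [Derive], so the inner derivative has to be identified on a whole
     neighbourhood before it is differentiated again. *)
  assert (Hloc : forall z, Rabs z < d -> locally z (fun z' => Rabs z' < d)).
  { intros z Hz. assert (He : 0 < d - Rabs z) by lra. exists (mkposreal _ He); intros z' Hz'.
    change (Rabs (z' - z) < d - Rabs z)%R in Hz'.
    replace z' with (z + (z' - z))%R by ring. pose proof (Rabs_triang z (z' - z)); lra. }
  assert (E1 : forall s t, Rabs s < d -> Rabs t < d ->
    is_derive (fun z => Derive (fun t' => pr (g (at_ z t'))) t) s (pr (gyx (at_ s t)))).
  { intros s t Hs Ht. apply (is_derive_ext_loc (fun z => pr (gy (at_ z t)))).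
    - generalize (Hloc s Hs); apply filter_imp; intros z Hz. symmetry.
      apply is_derive_unique, D2. now apply H; apply Hat.
    - apply D1. now apply H; apply Hat. }
  assert (E2 : forall s t, Rabs s < d -> Rabs t < d ->
    is_derive (fun z => Derive (fun s' => pr (g (at_ s' z))) s) t (pr (gxy (at_ s t)))).
  { intros s t Hs Ht. apply (is_derive_ext_loc (fun z => pr (gx (at_ s z)))).
    - generalize (Hloc t Ht); apply filter_imp; intros z Hz. symmetry.
      apply is_derive_unique, D1. now apply H; apply Hat.
    - apply D2. now apply H; apply Hat. }
  assert (HC : forall F (Fd : R -> R -> R), Kcont2_at k F (x, y) ->
    (forall s t, Rabs s < d -> Rabs t < d -> Fd s t = pr (F (at_ s t))) ->
    continuity_2d_pt Fd 0 0).
  { intros F Fd HF E eps. destruct (HF eps (cond_pos eps)) as (d' & Hd' & HF').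
    exists (mkposreal _ (Rmin_pos _ _ Hd Hd')); simpl; intros u v Hu Hv.
    rewrite Rminus_0_r in Hu, Hv. pose proof (Rmin_l d d'); pose proof (Rmin_r d d').
    rewrite !E by (try rewrite Rabs_R0; lra). destruct Hpr as (Psub & _ & Ple).
    rewrite <- Psub, Hat0. eapply Rle_lt_trans; [apply Ple |]. apply HF'.
    split; unfold at_; simpl.
    - replace (x + KofR k u * 1 - x) with (KofR k u) by ring. rewrite Knorm_KofR; lra.
    - replace (y + KofR k v * 1 - y) with (KofR k v) by ring. rewrite Knorm_KofR; lra. }
  assert (Z : Rabs 0 < d) by now rewrite Rabs_R0.
  destruct (H _ Hp) as (_ & _ & _ & _ & C1 & C2).
  rewrite <- Hat0, <- (is_derive_unique _ _ _ (E1 _ _ Z Z)), <- (is_derive_unique _ _ _ (E2 _ _ Z Z)).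
  symmetry; apply (Schwarz (fun s t => pr (g (at_ s t)))).
  - exists (mkposreal _ Hd); simpl; intros u v Hu Hv. rewrite Rminus_0_r in Hu, Hv.
    destruct (H _ (Hat u v Hu Hv)) as (Hx & Hy & _).
    repeat split; eexists; [apply D1, Hx | apply D2, Hy | now apply E1 | now apply E2].
  - apply (HC gyx); [assumption |]. intros; apply is_derive_unique; now apply E1.
  - apply (HC gxy); [assumption |]. intros; apply is_derive_unique; now apply E2.
Qed.

(** * Germs in two variables and their leading forms *)

Lemma pd2_ext b a r g g1 g' g1' p : ball2 k a r p ->
  (forall q, ball2 k a r q -> g q = g1 q) -> g' p = g1' p ->
  pd2 k b g g' p -> pd2 k b g1 g1' p.
Proof.
  intros Hp E E' H. destruct (ball2_open _ _ _ Hp) as (d & Hd & Hb).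
  destruct b; (eapply (hasderiv_ext _ _ _ _ _ _ Hd); [| exact E' | exact H]);
    intros h Hh; apply E, Hb; split; simpl.
  - replace (fst p - fst p) with (0 : K) by ring; now rewrite Knorm0.
  - now replace (snd p + h - snd p) with h by ring.
  - now replace (fst p + h - fst p) with h by ring.
  - replace (snd p - snd p) with (0 : K) by ring; now rewrite Knorm0.
Qed.

Lemma pd2_unique b g g' g1' p : pd2 k b g g' p -> pd2 k b g g1' p -> g' p = g1' p.
Proof. destruct b; apply hasderiv_unique. Qed.

Lemma pd2_sub b f g f' g' p : pd2 k b f f' p -> pd2 k b g g' p ->
  pd2 k b (fun q => f q - g q) (fun q => f' q - g' q) p.
Proof. destruct b; intros Hf Hg; exact (hasderiv_sub _ _ _ _ _ Hf Hg). Qed.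

Lemma partials_pd2 F Fx Fy b p : partials F Fx Fy -> pd2 k b F (if b then Fy else Fx) p.
Proof. intros [Hx Hy]; destruct b; auto. Qed.

Lemma iter_d2_mono a r r' w g h : r' <= r -> iter_d2 k a r w g h -> iter_d2 k a r' w g h.
Proof.
  intros Hr H; induction H; [constructor |].
  econstructor; [| exact IHiter_d2]. intros p Hp; eapply H, ball2_le; eassumption.
Qed.

(** For the empty word the iterated derivative is the function itself, which may differ outside the
    ball; hence a new [h1] agreeing with [h] only on the ball. *)
Lemma iter_d2_ext a r w g g1 h : (forall p, ball2 k a r p -> g p = g1 p) ->
  iter_d2 k a r w g h ->
  exists h1, iter_d2 k a r w g1 h1 /\ forall p, ball2 k a r p -> h1 p = h p.
Proof.
  intros E H; destruct H as [g | b w g g' h Hd H].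
  - exists g1; split; [constructor | symmetry; auto].
  - exists h; split; [| reflexivity]. econstructor; [| exact H].
    intros p Hp; eapply pd2_ext; eauto.
Qed.

Lemma Kcont2_ext a r g g1 p : ball2 k a r p -> (forall q, ball2 k a r q -> g q = g1 q) ->
  Kcont2_at k g p -> Kcont2_at k g1 p.
Proof.
  intros Hp E H eps He. destruct (H eps He) as (d & Hd & H').
  destruct (ball2_open _ _ _ Hp) as (d' & Hd' & Hb).
  exists (Rmin d d'); split; [now apply Rmin_pos |]; intros q Hq.
  rewrite <- (E p Hp), <- E by (apply Hb, (ball2_le _ _ _ _ Hq), Rmin_r).
  apply H', (ball2_le _ _ _ _ Hq), Rmin_l.
Qed.

Lemma Kcont2_const c p : Kcont2_at k (fun _ => c) p.
Proof.
  intros eps He; exists 1%R; split; [lra |]; intros.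
  replace (c - c) with (0 : K) by ring; now rewrite Knorm0.
Qed.

Lemma Kcont2_add f g p : Kcont2_at k f p -> Kcont2_at k g p ->
  Kcont2_at k (fun q => f q + g q) p.
Proof.
  intros Hf Hg eps He.
  destruct (Hf (eps / 2)%R ltac:(lra)) as (d & Hd & H), (Hg (eps / 2)%R ltac:(lra)) as (d' & Hd' & H').
  exists (Rmin d d'); split; [now apply Rmin_pos |]; intros q Hq.
  specialize (H q (ball2_le _ _ _ _ Hq (Rmin_l _ _))).
  specialize (H' q (ball2_le _ _ _ _ Hq (Rmin_r _ _))).
  replace (f q + g q - (f p + g p)) with (f q - f p + (g q - g p)) by ring.
  eapply Rle_lt_trans; [apply Knorm_triang | lra].
Qed.

Lemma Kcont2_mul f g p : Kcont2_at k f p -> Kcont2_at k g p ->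
  Kcont2_at k (fun q => f q * g q) p.
Proof.
  intros Hf Hg eps He. pose proof (Knorm_pos (f p)); pose proof (Knorm_pos (g p)).
  assert (H1 : 0 < eps / (2 * (norm (f p) + 1))) by (apply Rdiv_lt_0_compat; lra).
  assert (H2 : 0 < Rmin 1 (eps / (2 * (norm (g p) + 1)))).
  { apply Rmin_pos; [lra | apply Rdiv_lt_0_compat; lra]. }
  destruct (Hf _ H2) as (d & Hd & H'), (Hg _ H1) as (d' & Hd' & H1').
  exists (Rmin d d'); split; [now apply Rmin_pos |]; intros q Hq.
  specialize (H' q (ball2_le _ _ _ _ Hq (Rmin_l _ _))).
  specialize (H1' q (ball2_le _ _ _ _ Hq (Rmin_r _ _))).
  pose proof (Rmin_l 1 (eps / (2 * (norm (g p) + 1)))).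
  pose proof (Rmin_r 1 (eps / (2 * (norm (g p) + 1)))).
  set (u := f q - f p) in *; set (v := g q - g p) in *.
  replace (f q * g q - f p * g p) with (u * g p + (f p + u) * v) by (unfold u, v; ring).
  eapply Rle_lt_trans; [apply Knorm_triang |]. rewrite !Knorm_mul.
  pose proof (Knorm_triang (f p) u); pose proof (Knorm_pos u); pose proof (Knorm_pos v).
  pose proof (Knorm_pos (f p + u)).
  assert (norm u * norm (g p) <= eps / (2 * (norm (g p) + 1)) * norm (g p)) by (apply Rmult_le_compat_r; lra).
  assert (norm (f p + u) * norm v <= (norm (f p) + 1) * norm v) by (apply Rmult_le_compat_r; lra).
  assert ((norm (f p) + 1) * norm v < (norm (f p) + 1) * (eps / (2 * (norm (f p) + 1)))) by (apply Rmult_lt_compat_l; lra).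
  replace ((norm (f p) + 1) * (eps / (2 * (norm (f p) + 1))))%R with (eps / 2)%R in * by (field; lra).
  assert (eps / (2 * (norm (g p) + 1)) * norm (g p) <= eps / 2).
  { apply Rmult_le_reg_r with (2 * (norm (g p) + 1))%R; [lra |].
    replace (eps / (2 * (norm (g p) + 1)) * norm (g p) * (2 * (norm (g p) + 1)))%R
      with (eps * norm (g p))%R by (field; lra). nra. }
  lra.
Qed.

Lemma Kcont2_sub f g p : Kcont2_at k f p -> Kcont2_at k g p ->
  Kcont2_at k (fun q => f q - g q) p.
Proof.
  intros Hf Hg.
  replace (fun q => f q - g q) with (fun q => f q + (0 - 1) * g q)
    by (apply functional_extensionality; intros; ring).
  apply Kcont2_add; [assumption |]. apply Kcont2_mul; [apply Kcont2_const | assumption].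
Qed.

Lemma Kcont2_fst p : Kcont2_at k fst p.
Proof. intros eps He; exists eps; split; [assumption |]; now intros q []. Qed.

Lemma Kcont2_snd p : Kcont2_at k snd p.
Proof. intros eps He; exists eps; split; [assumption |]; now intros q []. Qed.

Lemma form_cont d F p : form d F -> Kcont2_at k F p.
Proof.
  intros H; induction H.
  - apply Kcont2_const.
  - apply Kcont2_mul; [| assumption]. apply Kcont2_add; apply Kcont2_mul;
      (apply Kcont2_const || apply Kcont2_fst || apply Kcont2_snd).
  - now apply Kcont2_add.
Qed.

(** * Smoothness on a fixed ball and the ideals m_0^l *)

Definition smooth_on (a : P2 k) (r : R) (u : P2 k -> K) : Prop :=
  forall w, exists h, iter_d2 k a r w u h /\ forall p, ball2 k a r p -> Kcont2_at k h p.

Lemma smooth_on_cont a r u p : smooth_on a r u -> ball2 k a r p -> Kcont2_at k u p.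
Proof. intros H Hp; destruct (H nil) as (h & Hh & C); inversion Hh; subst; auto. Qed.

(** Smoothness supplies a separate chain of derivatives for each word, and their first members need
    not coincide as functions. They agree on the ball by uniqueness, so one first derivative can be
    fixed and the other chains transported to it. *)
Lemma smooth_on_partial a r u b : smooth_on a r u ->
  exists u', (forall p, ball2 k a r p -> pd2 k b u u' p) /\ smooth_on a r u'.
Proof.
  intros H; destruct (H (b :: nil)) as (h & Hh & C).
  inversion Hh as [| ? ? ? u' ? Hd H']; subst; inversion H'; subst; clear H' Hh.
  exists h; split; [assumption |]. intros w.
  destruct (H (b :: w)) as (h2 & Hh2 & C2).
  inversion Hh2 as [| ? ? ? u2 ? Hd2 H2']; subst.
  destruct (iter_d2_ext a r w u2 h h2) as (h3 & Hh3 & E3); [| assumption |].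
  - intros p Hp; eapply pd2_unique; eauto.
  - exists h3; split; [assumption |]. intros p Hp.
    apply (Kcont2_ext a r h2); auto. intros; symmetry; auto.
Qed.

Lemma smooth_on_sub a r u v : smooth_on a r u -> smooth_on a r v ->
  smooth_on a r (fun p => u p - v p).
Proof.
  assert (H : forall w g h, iter_d2 k a r w g h -> forall g1 h1, iter_d2 k a r w g1 h1 ->
    iter_d2 k a r w (fun p => g p - g1 p) (fun p => h p - h1 p)).
  { intros w g h H; induction H; intros g1 h1 H1; inversion H1; subst; [constructor |].
    econstructor; [| apply IHiter_d2; eassumption].
    intros p Hp; apply pd2_sub; auto. }
  intros Hu Hv w; destruct (Hu w) as (h & Hh & C), (Hv w) as (h1 & Hh1 & C1).
  exists (fun p => h p - h1 p); split; [now apply H |].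
  intros; apply Kcont2_sub; auto.
Qed.

Lemma form_smooth_on a r d F : form d F -> smooth_on a r F.
Proof.
  intros H w; revert d F H; induction w as [| b w IH]; intros d F H.
  - exists F; split; [constructor | intros; now apply (form_cont d)].
  - assert (exists d' F', form d' F' /\ forall p, pd2 k b F F' p) as (d' & F' & HF' & HD).
    { destruct (form_partials d F H) as (Fx & Fy & Hx & Hy & HP).
      destruct d as [| d].
      (* The derivative of a constant would have degree -1; the zero function is used as a form of
         degree 0 instead. *)
      - exists 0%nat, (fun _ => 0); split; [constructor |]. intros p.
        generalize (partials_pd2 F Fx Fy b p HP); apply (pd2_ext b p 1).
        + apply ball2_center; lra.
        + reflexivity.
        + destruct b; auto.
      - exists d, (if b then Fy else Fx); split; [now destruct b |].
        intros p; now apply partials_pd2. }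
    destruct (IH d' F' HF') as (h & Hh & C). exists h; split; [| exact C].
    econstructor; [intros; apply HD | exact Hh].
Qed.

Lemma mem_m_value l u : mem_m k (S l) u -> u (P2zero k) = 0.
Proof. intros [_ H]; apply (H 1%R nil); [lra | simpl; lia | constructor]. Qed.

Lemma mem_m_partial l u b r u' : 0 < r -> mem_m k (S l) u ->
  (forall p, ball2 k (P2zero k) r p -> pd2 k b u u' p) -> smooth_on (P2zero k) r u' ->
  mem_m k l u'.
Proof.
  intros Hr [_ H] Hd Hs; split; [now exists r |]. intros r' w h Hr' Hw Hh.
  assert (Hm : 0 < Rmin r r') by now apply Rmin_pos.
  apply (H (Rmin r r') (b :: w)); [assumption | simpl; lia |].
  econstructor.
  - intros p Hp; apply Hd; exact (ball2_le _ _ _ _ Hp (Rmin_l _ _)).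
  - exact (iter_d2_mono _ _ _ _ _ _ (Rmin_r _ _) Hh).
Qed.

(** Together with [mem_m_value] and [mem_m_partial] this describes m_0^(l+1) by the value and the
    two first partials, which permits induction on l. *)
Lemma mem_m_intro l u ux uy r : 0 < r -> smooth_on (P2zero k) r u -> u (P2zero k) = 0 ->
  (forall p, ball2 k (P2zero k) r p -> pd2 k false u ux p /\ pd2 k true u uy p) ->
  mem_m k l ux -> mem_m k l uy -> mem_m k (S l) u.
Proof.
  intros Hr Hs H0 Hd [_ Hx] [_ Hy]; split; [now exists r |].
  intros r' [| b w] h Hr' Hw Hh; inversion Hh as [| ? ? ? u' ? Hd' H']; subst; [assumption |].
  assert (Hm : 0 < Rmin r r') by now apply Rmin_pos.
  apply (iter_d2_mono _ _ _ _ _ _ (Rmin_r r r')) in H'.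
  destruct (iter_d2_ext (P2zero k) (Rmin r r') w u' (if b then uy else ux) h) as (h1 & Hh1 & E); [| exact H' |].
  { intros p Hp; apply (pd2_unique b u).
    - apply Hd'; exact (ball2_le _ _ _ _ Hp (Rmin_r _ _)).
    - destruct (Hd p (ball2_le _ _ _ _ Hp (Rmin_l _ _))). now destruct b. }
  rewrite <- E by now apply ball2_center.
  simpl in Hw. destruct b; [eapply Hy | eapply Hx]; try exact Hh1; auto; lia.
Qed.

Lemma form_value0 d F : form (S d) F -> F (P2zero k) = 0.
Proof.
  intros H; unfold P2zero. replace (0, 0) with ((0 * 0, 0 * 0) : P2 k) by (f_equal; ring).
  rewrite (form_homogeneous (S d)) by assumption. simpl; ring.
Qed.

Lemma form_mem_m d F : form d F -> mem_m k d F.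
Proof.
  revert F; induction d; intros F H.
  - split; [exists 1%R; split; [lra | now apply (form_smooth_on _ _ 0)] |].
    simpl; intros; lia.
  - destruct (form_partials _ F H) as (Fx & Fy & Hx & Hy & [Px Py]).
    apply (mem_m_intro d F Fx Fy 1); auto; [lra | now apply (form_smooth_on _ _ (S d)) |].
    now apply (form_value0 d).
Qed.

(** * Orders of vanishing in two variables and leading forms *)

Definition norm2 (p : P2 k) : R := norm (fst p) + norm (snd p).

Lemma norm2_pos p : 0 <= norm2 p.
Proof. unfold norm2; pose proof (Knorm_pos (fst p)); pose proof (Knorm_pos (snd p)); lra. Qed.

Lemma ball2_zero r p : ball2 k (P2zero k) r p <-> norm (fst p) < r /\ norm (snd p) < r.
Proof.
  unfold ball2, P2zero; simpl.
  replace (fst p - 0) with (fst p) by ring; now replace (snd p - 0) with (snd p) by ring.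
Qed.

Definition vanishes (n : nat) (u : P2 k -> K) : Prop :=
  exists C r, 0 <= C /\ 0 < r /\
    forall p, ball2 k (P2zero k) r p -> norm (u p) <= C * norm2 p ^ n.

Lemma vanishes_sub n u v : vanishes n u -> vanishes n v -> vanishes n (fun p => u p - v p).
Proof.
  intros (C & r & HC & Hr & H) (C' & r' & HC' & Hr' & H').
  exists (C + C')%R, (Rmin r r'); repeat split; [lra | now apply Rmin_pos |]. intros p Hp.
  specialize (H p (ball2_le _ _ _ _ Hp (Rmin_l _ _))).
  specialize (H' p (ball2_le _ _ _ _ Hp (Rmin_r _ _))).
  eapply Rle_trans; [apply Knorm_sub_triang |]. lra.
Qed.

Lemma vanishes_ext n u v r : 0 < r -> (forall p, ball2 k (P2zero k) r p -> u p = v p) ->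
  vanishes n u -> vanishes n v.
Proof.
  intros Hr E (C & r' & HC & Hr' & H). exists C, (Rmin r r'); repeat split; [lra | now apply Rmin_pos |].
  intros p Hp. rewrite <- E by exact (ball2_le _ _ _ _ Hp (Rmin_l _ _)).
  apply H; exact (ball2_le _ _ _ _ Hp (Rmin_r _ _)).
Qed.

(** By induction both partials are O(|p|^l). The mean value inequality on the horizontal segment
    from the origin to (x, 0) and the vertical one from there to (x, y) gains one order. *)
Lemma mem_m_vanishes l u : mem_m k l u -> vanishes l u.
Proof.
  revert u; induction l; intros u Hu.
  - destruct Hu as [(r & Hr & Hs) _].
    assert (Hc : Kcont2_at k u (P2zero k)) by (eapply smooth_on_cont; [exact Hs | now apply ball2_center]).
    destruct (Hc 1%R Rlt_0_1) as (d & Hd & H).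
    exists (norm (u (P2zero k)) + 1)%R, d. pose proof (Knorm_pos (u (P2zero k))).
    repeat split; [lra | assumption |]. intros p Hp; specialize (H p Hp). simpl.
    replace (u p) with (u (P2zero k) + (u p - u (P2zero k))) by ring.
    pose proof (Knorm_triang (u (P2zero k)) (u p - u (P2zero k))); lra.
  - destruct (proj1 Hu) as (r & Hr & Hs).
    destruct (smooth_on_partial _ _ _ false Hs) as (ux & Dx & Sx).
    destruct (smooth_on_partial _ _ _ true Hs) as (uy & Dy & Sy).
    destruct (IHl ux (mem_m_partial l u _ r ux Hr Hu Dx Sx)) as (C & r1 & HC & Hr1 & H1).
    destruct (IHl uy (mem_m_partial l u _ r uy Hr Hu Dy Sy)) as (C' & r2 & HC' & Hr2 & H2).
    set (rr := Rmin r (Rmin r1 r2)).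
    assert (L0 : rr <= r) by apply Rmin_l.
    assert (L1 : rr <= r1) by (eapply Rle_trans; [apply Rmin_r | apply Rmin_l]).
    assert (L2 : rr <= r2) by (eapply Rle_trans; [apply Rmin_r | apply Rmin_r]).
    exists (2 * (C + C'))%R, rr; repeat split; [lra | repeat apply Rmin_pos; assumption |].
    intros [x y] Hp. apply ball2_zero in Hp; simpl in Hp; destruct Hp as [Hx Hy].
    pose proof (Knorm_pos x) as Px; pose proof (Knorm_pos y) as Py.
    assert (Hsc : forall t z, 0 <= t <= 1 -> norm (KofR k t * z) <= norm z).
    { intros t z Ht; rewrite Knorm_mul, Knorm_KofR, Rabs_pos_eq by lra.
      pose proof (Knorm_pos z); nra. }
    pose proof (norm2_pos (x, y)) as Pn. set (n := norm2 (x, y)) in *.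
    assert (En : n = (norm x + norm y)%R) by reflexivity.
    assert (M1 : norm (u (0 + x, 0) - u (0, 0)) <= 2 * (C * n ^ l) * norm x).
    { apply (mean_value_inequality (fun z => u (z, 0)) (fun z => ux (z, 0))).
      intros t Ht. pose proof (Hsc t x Ht).
      assert (B : forall r', rr <= r' -> ball2 k (P2zero k) r' (0 + KofR k t * x, 0)).
      { intros r' Hr'; apply ball2_zero; simpl. rewrite Knorm0.
        replace (0 + KofR k t * x) with (KofR k t * x) by ring. split; lra. }
      split; [exact (Dx _ (B r L0)) |].
      eapply Rle_trans; [exact (H1 _ (B r1 L1)) |].
      apply Rmult_le_compat_l; [assumption |]. apply pow_incr; split; [apply norm2_pos |].
      unfold norm2; simpl; rewrite Knorm0.
      replace (0 + KofR k t * x) with (KofR k t * x) by ring. lra. }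
    assert (M2 : norm (u (x, 0 + y) - u (x, 0)) <= 2 * (C' * n ^ l) * norm y).
    { apply (mean_value_inequality (fun z => u (x, z)) (fun z => uy (x, z))).
      intros t Ht. pose proof (Hsc t y Ht).
      assert (B : forall r', rr <= r' -> ball2 k (P2zero k) r' (x, 0 + KofR k t * y)).
      { intros r' Hr'; apply ball2_zero; simpl.
        replace (0 + KofR k t * y) with (KofR k t * y) by ring. split; lra. }
      split; [exact (Dy _ (B r L0)) |].
      eapply Rle_trans; [exact (H2 _ (B r2 L2)) |].
      apply Rmult_le_compat_l; [assumption |]. apply pow_incr; split; [apply norm2_pos |].
      unfold norm2; simpl.
      replace (0 + KofR k t * y) with (KofR k t * y) by ring. lra. }
    pose proof (mem_m_value l u Hu) as H0; unfold P2zero in H0. rewrite H0 in M1.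
    replace (0 + x) with x in M1 by ring. replace (0 + y) with y in M2 by ring.
    replace (u (x, y)) with (u (x, y) - u (x, 0) + (u (x, 0) - 0)) by ring.
    eapply Rle_trans; [apply Knorm_triang |].
    assert (Pp : 0 <= n ^ l) by now apply pow_le.
    simpl. assert (A1 : (n ^ l * norm x <= n ^ l * n)%R) by (apply Rmult_le_compat_l; lra).
    assert (A2 : (n ^ l * norm y <= n ^ l * n)%R) by (apply Rmult_le_compat_l; lra).
    nra.
Qed.

(** A form of degree d - 1 scales by t^(d-1) along p -> t p, whereas the bound scales by t^d;
    letting t tend to 0 forces F(p) = 0. *)
Lemma dform_eq0_of_vanishes d F : dform d F -> vanishes d F -> forall p, F p = 0.
Proof.
  destruct d as [| d]; [trivial |]. simpl. intros HF (C & r & HC & Hr & H) [x y].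
  apply Knorm_eq0. destruct (Req_dec (norm (F (x, y))) 0) as [| n]; [assumption | exfalso].
  pose proof (Knorm_pos (F (x, y))) as PF. pose proof (norm2_pos (x, y)) as Pn.
  set (m := norm (F (x, y))) in *. set (N := norm2 (x, y)) in *.
  set (B := (C * N ^ S d)%R).
  assert (PB : 0 <= B) by (apply Rmult_le_pos; [lra | now apply pow_le]).
  (* The first bound keeps t p in the ball, the second makes t B smaller than m. *)
  set (t := Rmin (r / (N + 1)) (m / (2 * (B + 1)))).
  assert (Ht : 0 < t) by (apply Rmin_pos; apply Rdiv_lt_0_compat; lra).
  assert (Ht1 : t * (N + 1) <= r).
  { apply Rle_trans with (r / (N + 1) * (N + 1))%R; [| right; field; lra].
    apply Rmult_le_compat_r; [lra | apply Rmin_l]. }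
  assert (Ht2 : t * (2 * (B + 1)) <= m).
  { apply Rle_trans with (m / (2 * (B + 1)) * (2 * (B + 1)))%R; [| right; field; lra].
    apply Rmult_le_compat_r; [lra | apply Rmin_r]. }
  assert (En : norm2 (KofR k t * x, KofR k t * y) = (t * N)%R).
  { unfold N, norm2; simpl. rewrite !Knorm_mul, Knorm_KofR, Rabs_pos_eq by lra. ring. }
  assert (HB : ball2 k (P2zero k) r (KofR k t * x, KofR k t * y)).
  { apply ball2_zero; simpl. pose proof (Knorm_pos (KofR k t * x)); pose proof (Knorm_pos (KofR k t * y)).
    unfold norm2 in En; simpl in En. split; nra. }
  specialize (H _ HB). rewrite En, (form_homogeneous d), Knorm_mul, Knorm_pow, Knorm_KofR,
    (Rabs_pos_eq t), Rpow_mult_distr in H by (assumption || lra). fold m in H.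
  simpl in H. assert (Pt : 0 < t ^ d) by now apply pow_lt.
  assert (H' : m <= t * B).
  { apply Rmult_le_reg_l with (t ^ d)%R; [assumption |].
    eapply Rle_trans; [exact H |]. unfold B; simpl; right; ring. }
  nra.
Qed.

Lemma mem_m_leading_form i u : mem_m k i u ->
  exists P, form i P /\ mem_m k (S i) (fun p => u p - P p).
Proof.
  revert u; induction i as [| i IH]; intros u Hu; destruct (proj1 Hu) as (r & Hr & Hs).
  - exists (fun _ => u (P2zero k)); split; [constructor |]. split.
    + exists r; split; [assumption |].
      apply (smooth_on_sub _ _ u); [exact Hs | apply (form_smooth_on _ _ 0); constructor].
    + intros r' [| b w] h Hr' Hw Hh; [| simpl in Hw; lia].
      inversion Hh; subst; ring.
  - destruct (smooth_on_partial _ _ _ false Hs) as (ux & Dx & Sx).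
    destruct (smooth_on_partial _ _ _ true Hs) as (uy & Dy & Sy).
    destruct (IH ux (mem_m_partial i u _ r ux Hr Hu Dx Sx)) as (A & HA & MA).
    destruct (IH uy (mem_m_partial i u _ r uy Hr Hu Dy Sy)) as (B & HB & MB).
    destruct (form_partials i A HA) as (Ax & Ay & FAx & FAy & PA).
    destruct (form_partials i B HB) as (Bx & By & FBx & FBy & PB).
    destruct (smooth_on_partial _ _ _ true Sx) as (uxy & Dxy & Sxy).
    destruct (smooth_on_partial _ _ _ false Sy) as (uyx & Dyx & Syx).
    assert (Hsd : forall F, dform i F -> smooth_on (P2zero k) r F).
    { intros F HF; destruct i as [| i]; [| now apply (form_smooth_on _ _ i)].
      apply (form_smooth_on _ _ 0), (form_ext 0 (fun _ => 0)); [constructor |].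
      intros; symmetry; apply HF. }
    (* The mixed derivatives coincide, so Bx - Ay is O(|p|^i); as a form of degree i - 1 it must
       then be zero. *)
    assert (V1 : vanishes i (fun p => uxy p - Ay p)).
    { apply mem_m_vanishes, (mem_m_partial i _ true r _ Hr MA).
      - intros p Hp; apply pd2_sub; [now apply Dxy | apply PA].
      - apply (smooth_on_sub _ _ uxy); auto. }
    assert (V2 : vanishes i (fun p => uyx p - Bx p)).
    { apply mem_m_vanishes, (mem_m_partial i _ false r _ Hr MB).
      - intros p Hp; apply pd2_sub; [now apply Dyx | apply PB].
      - apply (smooth_on_sub _ _ uyx); auto. }
    assert (ES : forall p, ball2 k (P2zero k) r p -> uxy p = uyx p).
    { intros p Hp; apply (schwarz_K _ r u ux uy _ _ p Hp). intros q Hq.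
      repeat split; auto; eapply smooth_on_cont; eauto. }
    assert (EAB : forall p, Bx p = Ay p).
    { intros p; apply Ksub_eq0.
      replace (Bx p - Ay p) with (Bx p + (0 - 1) * Ay p) by ring.
      apply (dform_eq0_of_vanishes i (fun p => Bx p + (0 - 1) * Ay p)).
      - destruct i; [| exact (form_add _ _ _ FBx (form_scal _ _ _ FAy))].
        intros q; rewrite FBx, FAy; ring.
      - apply (vanishes_ext i (fun p => (uxy p - Ay p) - (uyx p - Bx p)) _ r Hr);
          [intros q Hq; rewrite (ES q Hq); ring | now apply vanishes_sub]. }
    destruct (Kinv_ex (KofR k (INR (S i)))) as (e & He).
    { apply KofR_neq0, not_0_INR; lia. }
    rewrite S_INR, KofR_add in He.
    set (P := fun p => e * (fst p * A p + snd p * B p)).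
    assert (HP : form (S i) P).
    { apply (form_ext (S i) (fun p => e * ((1 * fst p + 0 * snd p) * A p + (0 * fst p + 1 * snd p) * B p)));
        [| intros; unfold P; ring].
      apply form_scal, form_add; [exact (form_lin 1 0 _ _ HA) | exact (form_lin 0 1 _ _ HB)]. }
    (* Using Bx = Ay and Euler's identity, d/dx (x A + y B) = A + x Ax + y Ay = (i + 1) A, and
       likewise for y; [e] is the inverse of i + 1. *)
    assert (DP : partials P A B).
    { destruct PA as [PAx PAy], PB as [PBx PBy]. split; intros p.
      - generalize (hasderiv_scal e _ _ _ (hasderiv_add _ _ _ _ _
          (hasderiv_mul _ _ _ _ _ (hasderiv_id (fst p)) (PAx p))
          (hasderiv_scal (snd p) _ _ _ (PBx p)))).
        apply (hasderiv_ext _ _ _ _ _ _ Rlt_0_1); [reflexivity |].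
        replace (fst p, snd p) with p by now destruct p. rewrite EAB.
        pose proof (form_euler i A Ax Ay p HA (conj PAx PAy)) as EA.
        transitivity (e * (1 * A p + (fst p * Ax p + snd p * Ay p))); [ring |].
        rewrite EA. transitivity ((KofR k (INR i) + 1) * e * A p); [ring |].
        rewrite He; ring.
      - generalize (hasderiv_scal e _ _ _ (hasderiv_add _ _ _ _ _
          (hasderiv_scal (fst p) _ _ _ (PAy p))
          (hasderiv_mul _ _ _ _ _ (hasderiv_id (snd p)) (PBy p)))).
        apply (hasderiv_ext _ _ _ _ _ _ Rlt_0_1); [reflexivity |].
        replace (fst p, snd p) with p by now destruct p. rewrite <- EAB.
        pose proof (form_euler i B Bx By p HB (conj PBx PBy)) as EB.
        transitivity (e * (1 * B p + (fst p * Bx p + snd p * By p))); [ring |].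
        rewrite EB. transitivity ((KofR k (INR i) + 1) * e * B p); [ring |].
        rewrite He; ring. }
    exists P; split; [assumption |].
    apply (mem_m_intro (S i) _ (fun p => ux p - A p) (fun p => uy p - B p) r); auto.
    + apply (smooth_on_sub _ _ u); [exact Hs | now apply (form_smooth_on _ _ (S i))].
    + rewrite (mem_m_value i u Hu), (form_value0 i P HP); ring.
    + intros p Hp; split; apply pd2_sub; auto; apply DP.
Qed.

(** * Vanishing orders of germs in one variable *)

Definition vanishes1 (c : K) (n : nat) (g : K -> K) : Prop :=
  exists C r, 0 <= C /\ 0 < r /\
    forall x, norm (x - c) < r -> norm (g x) <= C * norm (x - c) ^ n.

Lemma vanishes1_ext c n f g r : 0 < r -> (forall x, norm (x - c) < r -> f x = g x) ->
  vanishes1 c n f -> vanishes1 c n g.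
Proof.
  intros Hr E (C & r' & HC & Hr' & H).
  exists C, (Rmin r r'); repeat split; [assumption | now apply Rmin_pos |]. intros x Hx.
  rewrite <- E by exact (Rlt_le_trans _ _ _ Hx (Rmin_l _ _)).
  apply H; exact (Rlt_le_trans _ _ _ Hx (Rmin_r _ _)).
Qed.

Lemma vanishes1_zero c n : vanishes1 c n (fun _ => 0).
Proof.
  exists 0%R, 1%R; repeat split; [lra | lra |]; intros. rewrite Knorm0; lra.
Qed.

Lemma vanishes1_add c n f g : vanishes1 c n f -> vanishes1 c n g ->
  vanishes1 c n (fun x => f x + g x).
Proof.
  intros (C & r & HC & Hr & H) (C' & r' & HC' & Hr' & H').
  exists (C + C')%R, (Rmin r r'); repeat split; [lra | now apply Rmin_pos |]. intros x Hx.
  specialize (H x (Rlt_le_trans _ _ _ Hx (Rmin_l _ _))).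
  specialize (H' x (Rlt_le_trans _ _ _ Hx (Rmin_r _ _))).
  eapply Rle_trans; [apply Knorm_triang |]. lra.
Qed.

Lemma vanishes1_mul c n f g : Kcont_at k f c -> vanishes1 c n g ->
  vanishes1 c n (fun x => f x * g x).
Proof.
  intros Hf (C & r & HC & Hr & H). destruct (Hf 1%R Rlt_0_1) as (d & Hd & H').
  pose proof (Knorm_pos (f c)).
  exists ((norm (f c) + 1) * C)%R, (Rmin r d); repeat split; [nra | now apply Rmin_pos |].
  intros x Hx.
  specialize (H x (Rlt_le_trans _ _ _ Hx (Rmin_l _ _))).
  specialize (H' x (Rlt_le_trans _ _ _ Hx (Rmin_r _ _))).
  rewrite Knorm_mul, Rmult_assoc. apply Rmult_le_compat; try apply Knorm_pos; [| assumption].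
  replace (f x) with (f c + (f x - f c)) by ring.
  eapply Rle_trans; [apply Knorm_triang |]. lra.
Qed.

Lemma vanishes1_poly c n f g : poly1 f -> vanishes1 c n g -> vanishes1 c n (fun x => f x * g x).
Proof. intros Hf; apply vanishes1_mul; now apply poly1_cont. Qed.

Lemma eq0_of_le_linear (x M r : R) : 0 <= x -> 0 < r ->
  (forall t, 0 < t < r -> x <= M * t) -> x = 0%R.
Proof.
  intros Hx Hr H. destruct (Req_dec x 0) as [| n]; [assumption | exfalso].
  assert (HM : 0 < Rabs M + 1) by (pose proof (Rabs_pos M); lra).
  set (t := Rmin (r / 2) (x / (2 * (Rabs M + 1)))).
  assert (Ht : 0 < t) by (apply Rmin_pos; [lra |]; apply Rdiv_lt_0_compat; lra).
  assert (Ht1 : t <= r / 2) by apply Rmin_l.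
  assert (Ht2 : t * (2 * (Rabs M + 1)) <= x).
  { apply Rle_trans with (x / (2 * (Rabs M + 1)) * (2 * (Rabs M + 1)))%R; [| right; field; lra].
    apply Rmult_le_compat_r; [lra | apply Rmin_r]. }
  specialize (H t ltac:(lra)). pose proof (Rle_abs M). nra.
Qed.

(** Comparison of coefficients up to order one. Only t <> 0 is tested, so that the estimate may come
    from one divided by a power of t. *)
Lemma affine_eq0 (a b : K) C r : 0 <= C -> 0 < r ->
  (forall t, t <> 0 -> norm t < r -> norm (a + b * t) <= C * norm t ^ 2) -> a = 0 /\ b = 0.
Proof.
  intros HC Hr H. pose proof (Knorm_pos b) as Pb.
  assert (Ht : forall t : R, 0 < t < Rmin r 1 ->
    norm (KofR k t) = t /\ norm (a + b * KofR k t) <= C * t ^ 2 /\ t ^ 2 <= t).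
  { intros t Ht. pose proof (Rmin_l r 1); pose proof (Rmin_r r 1).
    assert (E : norm (KofR k t) = t) by (rewrite Knorm_KofR; apply Rabs_pos_eq; lra).
    split; [assumption |]. split; [| nra]. rewrite <- E at 2. apply H; [| rewrite E; lra].
    apply KofR_neq0; lra. }
  assert (Ea : a = 0).
  { apply Knorm_eq0, (eq0_of_le_linear _ (C + norm b) (Rmin r 1)); [apply Knorm_pos | apply Rmin_pos; lra |].
    intros t Hlt; destruct (Ht t Hlt) as (E & H1 & H2).
    replace a with (a + b * KofR k t - b * KofR k t) by ring.
    eapply Rle_trans; [apply Knorm_sub_triang |]. rewrite Knorm_mul, E. nra. }
  split; [assumption |].
  apply Knorm_eq0, (eq0_of_le_linear _ C (Rmin r 1)); [assumption | apply Rmin_pos; lra |].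
  intros t Hlt; destruct (Ht t Hlt) as (E & H1 & H2).
  replace (a + b * KofR k t) with (b * KofR k t) in H1 by (rewrite Ea; ring).
  rewrite Knorm_mul, E in H1. apply Rmult_le_reg_r with t; [lra |]. simpl in H1; lra.
Qed.

(** * The kernels for multicusps *)

Section Multicusp.
Context (th : nat -> R) (s : nat -> K).
Local Notation f := (multicusp k th s).
Local Notation c_ m := (KofR k (cos (th m))).
Local Notation s_ m := (KofR k (sin (th m))).

Lemma unit_line m : c_ m * c_ m + s_ m * s_ m = 1.
Proof.
  rewrite <- !KofR_mul, <- KofR_add. f_equal.
  pose proof (sin2_cos2 (th m)) as H; unfold Rsqr in H; lra.
Qed.

Lemma multicusp_eq m x : f m x =
  ((x - s m) * (x - s m) * (c_ m + (x - s m) * - s_ m),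
   (x - s m) * (x - s m) * (s_ m + (x - s m) * c_ m)).
Proof. unfold multicusp, rotK, cuspK; simpl; f_equal; ring. Qed.

Lemma poly1_shift m : poly1 (fun x => x - s m).
Proof. apply poly1_sub; constructor. Qed.

Definition cusp_velocity (m : nat) (x : K) : P2 k :=
  ((1 + 1) * (x - s m) * c_ m - (1 + 1 + 1) * ((x - s m) * (x - s m)) * s_ m,
   (1 + 1) * (x - s m) * s_ m + (1 + 1 + 1) * ((x - s m) * (x - s m)) * c_ m).

Lemma multicusp_deriv m x :
  hasderiv k (fun t => fst (f m t)) x (fst (cusp_velocity m x)) /\
  hasderiv k (fun t => snd (f m t)) x (snd (cusp_velocity m x)).
Proof.
  assert (H1 : hasderiv k (fun t => t - s m) x (1 - 0)).
  { apply hasderiv_sub; [apply hasderiv_id | apply hasderiv_const]. }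
  pose proof (hasderiv_mul _ _ _ _ _ H1 H1) as H2.
  split.
  - generalize (hasderiv_mul _ _ _ _ _ H2 (hasderiv_add _ _ _ _ _
      (hasderiv_const (c_ m) x) (hasderiv_scal (- s_ m) _ _ _ H1))).
    apply (hasderiv_ext _ _ _ _ _ _ Rlt_0_1); intros; [rewrite multicusp_eq |]; simpl; ring.
  - generalize (hasderiv_mul _ _ _ _ _ H2 (hasderiv_add _ _ _ _ _
      (hasderiv_const (s_ m) x) (hasderiv_scal (c_ m) _ _ _ H1))).
    apply (hasderiv_ext _ _ _ _ _ _ Rlt_0_1); intros; [rewrite multicusp_eq |]; simpl; ring.
Qed.

Definition pull_sum (L : list ((P2 k -> K) * (nat -> K -> P2 k))) (m : nat) (x : K) : P2 k :=
  fold_right (fun uv acc => P2add k (P2scale k (fst uv (f m x)) (snd uv m x)) acc) (P2zero k) L.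

Lemma pull_sum_app L L' m x : pull_sum (L ++ L') m x = P2add k (pull_sum L m x) (pull_sum L' m x).
Proof.
  induction L as [| uv L IH]; simpl; [now rewrite P2add_zero_l |].
  rewrite IH; unfold P2add; simpl; f_equal; ring.
Qed.

Lemma pull_sum_map (c : P2 k -> K) L m x :
  pull_sum (map (fun uv => (fun p => c p * fst uv p, snd uv)) L) m x
  = P2scale k (c (f m x)) (pull_sum L m x).
Proof.
  induction L as [| uv L IH]; simpl; [unfold P2scale, P2zero; simpl; f_equal; ring |].
  rewrite IH; unfold P2add, P2scale; simpl; f_equal; ring.
Qed.

(* [(x - s m)^2] is the combination [cos (th m) X + sin (th m) Y] of the two
   components of the branch [m], so it can be traded for a form of degree one. *)
Lemma pull_forms l (v : nat -> K -> P2 k) :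
  (forall m, poly1 (fun x => fst (v m x)) /\ poly1 (fun x => snd (v m x))) ->
  exists L, (forall uv, In uv L -> form l (fst uv) /\
      forall m, poly1 (fun x => fst (snd uv m x)) /\ poly1 (fun x => snd (snd uv m x))) /\
    forall m x, pull_sum L m x = P2scale k (((x - s m) * (x - s m)) ^ l) (v m x).
Proof.
  revert v; induction l as [| l IH]; intros v Hv.
  - exists ((fun _ => 1, v) :: nil); split.
    + intros uv [<- | []]; split; [exact (form_const 1) | exact Hv].
    + intros m x; unfold pull_sum; simpl. rewrite P2add_zero_r; reflexivity.
  - destruct (IH (fun m x => P2scale k (c_ m) (v m x))) as (L & HL & EL).
    { intros m; destruct (Hv m); split; apply poly1_mul; (assumption || apply poly1_const). }
    destruct (IH (fun m x => P2scale k (s_ m) (v m x))) as (L' & HL' & EL').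
    { intros m; destruct (Hv m); split; apply poly1_mul; (assumption || apply poly1_const). }
    exists (map (fun uv => (fun p => fst p * fst uv p, snd uv)) L
            ++ map (fun uv => (fun p => snd p * fst uv p, snd uv)) L'); split.
    + intros uv Huv; apply in_app_or in Huv; destruct Huv as [H | H];
        apply in_map_iff in H; destruct H as ([u w] & <- & H0).
      * destruct (HL _ H0) as [HF HP]; split; [| exact HP].
        apply (form_ext _ _ _ (form_lin 1 0 _ _ HF)); intros; simpl; ring.
      * destruct (HL' _ H0) as [HF HP]; split; [| exact HP].
        apply (form_ext _ _ _ (form_lin 0 1 _ _ HF)); intros; simpl; ring.
    + intros m x. rewrite pull_sum_app, !pull_sum_map, EL, EL', multicusp_eq.
      set (t := x - s m). pose proof (unit_line m) as U.
      unfold P2add, P2scale; simpl; f_equal.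
      * transitivity ((c_ m * c_ m + s_ m * s_ m) * (t * t * (t * t) ^ l * fst (v m x))); [ring |].
        rewrite U; ring.
      * transitivity ((c_ m * c_ m + s_ m * s_ m) * (t * t * (t * t) ^ l * snd (v m x))); [ring |].
        rewrite U; ring.
Qed.

Lemma pullmod_intro l (J : nat -> Prop) (v a : nat -> K -> P2 k) :
  (forall m, poly1 (fun x => fst (v m x)) /\ poly1 (fun x => snd (v m x))) ->
  (forall m x, J m -> a m x = P2scale k (((x - s m) * (x - s m)) ^ l) (v m x)) ->
  pullmod k l J s f a.
Proof.
  intros Hv Ha; destruct (pull_forms l v Hv) as (L & HL & EL). exists L; split.
  - intros uv Huv; destruct (HL uv Huv) as [HF HP]; split; [now apply form_mem_m |].
    intros m _; split; apply poly1_smooth, HP.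
  - intros m Hm; exists 1%R; split; [lra |]. intros x _; rewrite (Ha m x Hm). symmetry; apply EL.
Qed.

Lemma form_multicusp d F m x : form d F -> F (f m x) = ((x - s m) * (x - s m)) ^ d *
  F (c_ m + (x - s m) * - s_ m, s_ m + (x - s m) * c_ m).
Proof. intros H; rewrite multicusp_eq; now apply form_homogeneous. Qed.

(** The field [eta] is chosen so that the v-components of P o f and of eta times the velocity agree
    exactly. What remains points along w, and the two conditions encoded in G(v) = 0 remove its
    terms of orders 2i and 2i + 1. *)
Lemma ker_omega_intro i (J : nat -> Prop) P G : (1 <= i)%nat -> vform i P -> psi P G ->
  (forall m, J m -> G (c_ m, s_ m) = P2zero k) -> ker_omega k i J s f P.
Proof.
  intros Hi HP (Nx & Ny & HN & HG) H0. destruct i as [| i]; [lia |].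
  destruct HP as [HP1 HP2].
  split; [split; now apply form_mem_m |].
  destruct (Kinv_ex (1 + 1 : K)) as (half & Hhalf).
  { rewrite <- KofR_add; apply KofR_neq0; lra. }
  destruct (form_partials _ _ HP1) as (Ax & Ay & _ & _ & DA).
  destruct (form_partials _ _ HP2) as (Bx & By & _ & _ & DB).
  destruct (form_line _ _ _ _ HP1 DA) as (g1 & L1).
  destruct (form_line _ _ _ _ HP2 DB) as (g2 & L2).
  destruct (form_line _ _ _ _ (form_cross _ P (conj HP1 HP2)) HN) as (gN & LN).
  set (along := fun (F : P2 k -> K) m x => F (c_ m + (x - s m) * - s_ m, s_ m + (x - s m) * c_ m)).
  set (T := fun m x => c_ m * along (fun p => fst (P p)) m x
                     + s_ m * along (fun p => snd (P p)) m x).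
  (* Defined by <P(v + t w), v> = <P(v), v> + t q. *)
  set (q := fun m x =>
    c_ m * ((- s_ m * Ax (c_ m, s_ m) + c_ m * Ay (c_ m, s_ m))
            + (x - s m) * g1 (c_ m) (s_ m) (- s_ m) (c_ m) (x - s m))
    + s_ m * ((- s_ m * Bx (c_ m, s_ m) + c_ m * By (c_ m, s_ m))
            + (x - s m) * g2 (c_ m) (s_ m) (- s_ m) (c_ m) (x - s m))).
  (* The coefficient of t^2 left in <P(v + t w), w> after subtracting (3/2) t <P(v + t w), v>; see
     [En] below. *)
  set (h := fun m x => gN (c_ m) (s_ m) (- s_ m) (c_ m) (x - s m) - half * q m x).
  assert (Pg : forall (g : K -> K -> K -> K -> K -> K) m, (forall v1 v2 w1 w2, poly1 (g v1 v2 w1 w2)) ->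
    poly1 (fun x => g (c_ m) (s_ m) (- s_ m) (c_ m) (x - s m))).
  { intros g m Hg; apply (poly1_comp (g (c_ m) (s_ m) (- s_ m) (c_ m))); [apply Hg | apply poly1_shift]. }
  assert (Pal : forall d F m, form d F -> poly1 (fun x => along F m x)).
  { intros d F m HF; apply (form_poly1 d F); [assumption | |];
      apply poly1_add, poly1_mul; (apply poly1_const || apply poly1_shift). }
  assert (PT : forall m, poly1 (T m)).
  { intros m; apply poly1_add; apply poly1_mul; try apply poly1_const; eapply Pal; eassumption. }
  assert (Ph : forall m, poly1 (h m)).
  { intros m; apply poly1_sub; [apply Pg; intros; apply LN |].
    apply poly1_mul; [constructor |].
    apply poly1_add; (apply poly1_mul; [constructor |]); (apply poly1_add; [constructor |]);
      (apply poly1_mul; [apply poly1_shift |]); apply Pg; intros; [apply L1 | apply L2]. }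
  (* The degree is now i + 1, so the exponent 2 (i + 1) - 1 of t becomes 2i + 1. The v-component of
     the velocity is 2 t, hence the factor one half. *)
  set (eta := fun m x => ((x - s m) * (x - s m)) ^ i * ((x - s m) * (half * T m x))).
  exists (fun m x => P2scale k (eta m x) (cusp_velocity m x)),
         (fun m x => P2scale k (((x - s m) * (x - s m)) ^ S (S i)) (h m x * - s_ m, h m x * c_ m)).
  split; [| split; [| split]].
  - exists eta, cusp_velocity; split.
    + intros m _; apply poly1_smooth, poly1_mul.
      * apply poly1_pow, poly1_mul; apply poly1_shift.
      * apply poly1_mul; [apply poly1_shift |]. apply poly1_mul; [constructor | apply PT].
    + intros m _; exists 1%R; split; [lra |]. intros x _.
      destruct (multicusp_deriv m x); auto.
  - apply (pullmod_intro _ _ (fun m x =>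
      (T m x * (c_ m - half * (1 + 1 + 1) * (x - s m) * s_ m),
       T m x * (s_ m + half * (1 + 1 + 1) * (x - s m) * c_ m)))).
    + intros m; split; simpl; (apply poly1_mul; [apply PT |]); [apply poly1_sub | apply poly1_add];
        repeat (apply poly1_mul || apply poly1_const || apply poly1_shift).
    + intros m x _. unfold eta, P2scale, cusp_velocity; simpl.
      set (t := x - s m); set (W := (t * t) ^ i). f_equal.
      * transitivity (W * (t * t) * T m x * ((1 + 1) * half * c_ m - half * (1 + 1 + 1) * t * s_ m)); [ring |].
        rewrite Hhalf; ring.
      * transitivity (W * (t * t) * T m x * ((1 + 1) * half * s_ m + half * (1 + 1 + 1) * t * c_ m)); [ring |].
        rewrite Hhalf; ring.
  - apply (pullmod_intro _ _ (fun m x => (h m x * - s_ m, h m x * c_ m))); [| reflexivity].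
    intros m; split; simpl; (apply poly1_mul; [apply Ph | constructor]).
  - intros m Hm; exists 1%R; split; [lra |]. intros x _.
    pose proof (unit_line m) as U.
    destruct (proj1 (psi_eq0_iff _ P G Nx Ny _ _ U (conj HP1 HP2) HN HG) (H0 m Hm)) as [E1 E2].
    destruct (L1 (c_ m) (s_ m) (- s_ m) (c_ m)) as [_ M1].
    destruct (L2 (c_ m) (s_ m) (- s_ m) (c_ m)) as [_ M2].
    destruct (LN (c_ m) (s_ m) (- s_ m) (c_ m)) as [_ MN].
    specialize (M1 (x - s m)); specialize (M2 (x - s m)); specialize (MN (x - s m)).
    rewrite (surjective_pairing (P (f m x))).
    rewrite (form_multicusp _ (fun p => fst (P p)) m x HP1), (form_multicusp _ (fun p => snd (P p)) m x HP2).
    unfold eta, P2scale, P2add, cusp_velocity; simpl.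
    assert (ET : T m x = c_ m * fst (P (c_ m, s_ m)) + s_ m * snd (P (c_ m, s_ m)) + (x - s m) * q m x).
    { unfold T, along, q. rewrite M1, M2; ring. }
    assert (Eh : h m x = gN (c_ m) (s_ m) (- s_ m) (c_ m) (x - s m) - half * q m x) by reflexivity.
    unfold cross in MN at 1; simpl in MN. rewrite E1 in MN.
    set (t := x - s m) in *. set (W := (t * t) ^ i).
    unfold T, along in *. fold t in ET |- *.
    set (p1 := fst (P (c_ m + t * - s_ m, s_ m + t * c_ m))) in *.
    set (p2 := snd (P (c_ m + t * - s_ m, s_ m + t * c_ m))) in *.
    set (gNt := gN (c_ m) (s_ m) (- s_ m) (c_ m) t) in *.
    set (TT := c_ m * p1 + s_ m * p2) in *.
    (* Since N(v + t w) = <P, w> - t <P, v> at v + t w, the left side is t TT + N(v + t w).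
       Expanding N, with N(v) = 0 and 2 dN(v)(w) = <P(v), v> = TT - t q, gives the claim. *)
    assert (En : c_ m * p2 - s_ m * p1 = half * (1 + 1 + 1) * t * TT + t * t * h m x).
    { transitivity (t * TT + ((c_ m + t * - s_ m) * p2 - (s_ m + t * c_ m) * p1)); [unfold TT; ring |].
      rewrite MN, Eh.
      transitivity (t * TT + t * (((1 + 1) * half) * (c_ m * Ny (c_ m, s_ m) - s_ m * Nx (c_ m, s_ m)))
        + t * t * gNt); [rewrite Hhalf; ring |].
      transitivity (t * TT + t * half * ((1 + 1) * (c_ m * Ny (c_ m, s_ m) - s_ m * Nx (c_ m, s_ m)))
        + t * t * gNt); [ring |].
      rewrite E2.
      transitivity (t * TT + t * half * (TT - t * q m x) + t * t * gNt); [rewrite ET; ring |].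
      transitivity ((1 + 1) * half * t * TT + t * half * (TT - t * q m x) + t * t * gNt);
        [rewrite Hhalf; ring | ring]. }
    f_equal.
    + transitivity (W * (t * t) * ((c_ m * c_ m + s_ m * s_ m) * p1)); [rewrite U; ring |].
      transitivity (W * (t * t) * (c_ m * TT - s_ m * (c_ m * p2 - s_ m * p1))); [unfold TT; ring |].
      rewrite En.
      transitivity (W * (t * t) * ((1 + 1) * half * c_ m * TT
         - s_ m * (half * (1 + 1 + 1) * t * TT + t * t * h m x))); [rewrite Hhalf; ring | ring].
    + transitivity (W * (t * t) * ((c_ m * c_ m + s_ m * s_ m) * p2)); [rewrite U; ring |].
      transitivity (W * (t * t) * (s_ m * TT + c_ m * (c_ m * p2 - s_ m * p1))); [unfold TT; ring |].
      rewrite En.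
      transitivity (W * (t * t) * ((1 + 1) * half * s_ m * TT
         + c_ m * (half * (1 + 1 + 1) * t * TT + t * t * h m x))); [rewrite Hhalf; ring | ring].
Qed.

Lemma vanishes_multicusp n u m : vanishes n u -> vanishes1 (s m) (2 * n) (fun x => u (f m x)).
Proof.
  intros (C & r & HC & Hr & H).
  (* For |t| < 1 each component of the branch is at most 2 |t|^2, so their sum is at most 4 |t|^2;
     |t| < r / 2 then keeps the branch inside the ball of radius r. *)
  exists (C * 4 ^ n)%R, (Rmin 1 (r / 2)); repeat split.
  - apply Rmult_le_pos; [assumption | apply pow_le; lra].
  - apply Rmin_pos; lra.
  - intros x Hx. pose proof (Rlt_le_trans _ _ _ Hx (Rmin_l _ _)) as X1.
    pose proof (Rlt_le_trans _ _ _ Hx (Rmin_r _ _)) as X2.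
    set (t := x - s m) in *. pose proof (Knorm_pos t) as Pt.
    assert (Hc : norm (c_ m) <= 1) by (rewrite Knorm_KofR; apply Rabs_le; pose proof (COS_bound (th m)); lra).
    assert (Hs : norm (s_ m) <= 1) by (rewrite Knorm_KofR; apply Rabs_le; pose proof (SIN_bound (th m)); lra).
    pose proof (Knorm_pos (c_ m)); pose proof (Knorm_pos (s_ m)).
    assert (B : forall a b : K, norm a <= 1 -> norm b <= 1 -> norm (t * t * (a + t * b)) <= 2 * norm t ^ 2).
    { intros a b Ha Hb; rewrite !Knorm_mul. pose proof (Knorm_triang a (t * b)) as Ht.
      rewrite Knorm_mul in Ht. pose proof (Knorm_pos b).
      assert (norm (a + t * b) <= 2) by nra. nra. }
    pose proof (B _ _ Hc (eq_ind_r (fun z => z <= 1) Hs (Knorm_opp (s_ m)))) as B1.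
    pose proof (B _ _ Hs Hc) as B2.
    assert (Hn : norm2 (f m x) <= 4 * norm t ^ 2).
    { rewrite multicusp_eq; unfold norm2; cbn [fst snd]; fold t. lra. }
    eapply Rle_trans; [apply H |].
    + apply ball2_zero; rewrite multicusp_eq; cbn [fst snd]; fold t. split; nra.
    + rewrite Rmult_assoc. apply Rmult_le_compat_l; [assumption |].
      rewrite pow_mult, <- Rpow_mult_distr.
      apply pow_incr; split; [apply norm2_pos | assumption].
Qed.

Lemma pullmod_vanishes l (J : nat -> Prop) a m : J m -> pullmod k l J s f a ->
  vanishes1 (s m) (2 * l) (fun x => fst (a m x)) /\ vanishes1 (s m) (2 * l) (fun x => snd (a m x)).
Proof.
  intros Hm (L & HL & E). destruct (E m Hm) as (r & Hr & Er); clear E.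
  assert (H : vanishes1 (s m) (2 * l) (fun x => fst (pull_sum L m x)) /\
              vanishes1 (s m) (2 * l) (fun x => snd (pull_sum L m x))).
  { clear Er; induction L as [| uv L IH]; [split; apply vanishes1_zero |].
    destruct IH as [I1 I2]; [intros; apply HL; now right |].
    destruct (HL uv (or_introl eq_refl)) as [Hu Hv]. destruct (Hv m Hm) as [V1 V2].
    pose proof (vanishes_multicusp l _ m (mem_m_vanishes l _ Hu)) as Vu.
    split; simpl.
    - apply vanishes1_add; [| exact I1].
      apply (vanishes1_ext _ _ (fun x => fst (snd uv m x) * fst uv (f m x)) _ 1 Rlt_0_1);
        [intros; simpl; ring |]. apply vanishes1_mul; [now apply smooth1_cont | exact Vu].
    - apply vanishes1_add; [| exact I2].
      apply (vanishes1_ext _ _ (fun x => snd (snd uv m x) * fst uv (f m x)) _ 1 Rlt_0_1);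
        [intros; simpl; ring |]. apply vanishes1_mul; [now apply smooth1_cont | exact Vu]. }
  destruct H as [H1 H2]; split.
  - apply (vanishes1_ext _ _ _ _ r Hr) with (2 := H1). intros x Hx; now rewrite (Er x Hx).
  - apply (vanishes1_ext _ _ _ _ r Hr) with (2 := H2). intros x Hx; now rewrite (Er x Hx).
Qed.

(** Pairing P o f with 2 w - 3 t v gives t^(2i) (2 N(v + t w) - t <P(v + t w), v>). The multiple of
    the velocity drops out and the other terms are O(t^(2i+2)), so the coefficients of 1 and t in
    the bracket vanish; these are the two conditions of [psi_eq0_iff]. *)
Lemma ker_omega_elim i (J : nat -> Prop) xi P G m : ker_omega k i J s f xi -> vform i P ->
  mem_mtheta k (S i) (fun p => P2sub k (xi p) (P p)) -> psi P G -> J m ->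
  G (c_ m, s_ m) = P2zero k.
Proof.
  intros (_ & a & b & (eta & D & _ & HD) & _ & Hb & Hab) HP [R1 R2] (Nx & Ny & HN & HG) Hm.
  pose proof (unit_line m) as U.
  apply (psi_eq0_iff _ P G Nx Ny _ _ U HP HN HG).
  destruct HP as [HP1 HP2].
  destruct (form_partials _ _ HP1) as (Ax & Ay & _ & _ & DA).
  destruct (form_partials _ _ HP2) as (Bx & By & _ & _ & DB).
  destruct (form_line _ _ _ _ HP1 DA) as (g1 & L1).
  destruct (form_line _ _ _ _ HP2 DB) as (g2 & L2).
  destruct (form_line _ _ _ _ (form_cross _ P (conj HP1 HP2)) HN) as (gN & LN).
  destruct (L1 (c_ m) (s_ m) (- s_ m) (c_ m)) as [Pg1 M1].
  destruct (L2 (c_ m) (s_ m) (- s_ m) (c_ m)) as [Pg2 M2].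
  destruct (LN (c_ m) (s_ m) (- s_ m) (c_ m)) as [PgN MN].
  destruct (pullmod_vanishes _ _ _ m Hm Hb) as [V1 V2].
  pose proof (vanishes_multicusp _ _ m (mem_m_vanishes _ _ R1)) as W1.
  pose proof (vanishes_multicusp _ _ m (mem_m_vanishes _ _ R2)) as W2.
  (* From xi o f = a + b one gets P o f = a + (b - (xi - P) o f); both parts of the error have order
     at least 2i + 2. *)
  set (e1 := fun x => fst (b m x) + (0 - 1) * fst (P2sub k (xi (f m x)) (P (f m x)))).
  set (e2 := fun x => snd (b m x) + (0 - 1) * snd (P2sub k (xi (f m x)) (P (f m x)))).
  assert (Ve1 : vanishes1 (s m) (2 * S i) e1).
  { apply vanishes1_add; [exact V1 |]. apply (vanishes1_poly _ _ (fun _ => 0 - 1)); [constructor | exact W1]. }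
  assert (Ve2 : vanishes1 (s m) (2 * S i) e2).
  { apply vanishes1_add; [exact V2 |]. apply (vanishes1_poly _ _ (fun _ => 0 - 1)); [constructor | exact W2]. }
  (* The combination of the error terms in which the unknown multiple of the
     velocity of the cusp cancels. *)
  set (e := fun x => ((1 + 1) * - s_ m - (1 + 1 + 1) * (x - s m) * c_ m) * e1 x
                   + ((1 + 1) * c_ m - (1 + 1 + 1) * (x - s m) * s_ m) * e2 x).
  assert (Ve : vanishes1 (s m) (2 * S i) e).
  { apply vanishes1_add.
    - apply (vanishes1_poly _ _ (fun x => (1 + 1) * - s_ m - (1 + 1 + 1) * (x - s m) * c_ m)); [| exact Ve1].
      apply poly1_sub; repeat (apply poly1_mul || apply poly1_const || apply poly1_shift).
    - apply (vanishes1_poly _ _ (fun x => (1 + 1) * c_ m - (1 + 1 + 1) * (x - s m) * s_ m)); [| exact Ve2].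
      apply poly1_sub; repeat (apply poly1_mul || apply poly1_const || apply poly1_shift). }
  set (T0 := c_ m * fst (P (c_ m, s_ m)) + s_ m * snd (P (c_ m, s_ m))).
  set (N1 := c_ m * Ny (c_ m, s_ m) - s_ m * Nx (c_ m, s_ m)).
  set (q := fun t =>
    c_ m * ((- s_ m * Ax (c_ m, s_ m) + c_ m * Ay (c_ m, s_ m))
            + t * g1 (c_ m) (s_ m) (- s_ m) (c_ m) t)
    + s_ m * ((- s_ m * Bx (c_ m, s_ m) + c_ m * By (c_ m, s_ m))
            + t * g2 (c_ m) (s_ m) (- s_ m) (c_ m) t)).
  set (h := fun t => (1 + 1) * gN (c_ m) (s_ m) (- s_ m) (c_ m) t - q t).
  assert (Ph : poly1 h).
  { apply poly1_sub; [apply poly1_mul; [constructor | exact PgN] |].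
    apply poly1_add; (apply poly1_mul; [constructor |]); (apply poly1_add; [constructor |]);
      (apply poly1_mul; [constructor |]); assumption. }
  destruct (HD m Hm) as (r1 & Hr1 & HD1), (Hab m Hm) as (r2 & Hr2 & Hab2).
  assert (Key : forall x, norm (x - s m) < Rmin r1 r2 ->
    ((x - s m) * (x - s m)) ^ i * ((1 + 1) * cross P (c_ m, s_ m)
       + (x - s m) * ((1 + 1) * N1 - T0) + (x - s m) * (x - s m) * h (x - s m)) = e x).
  { intros x Hx. destruct (HD1 x (Rlt_le_trans _ _ _ Hx (Rmin_l _ _))) as (D1 & D2 & Ea).
    specialize (Hab2 x (Rlt_le_trans _ _ _ Hx (Rmin_r _ _))). cbv beta in Hab2.
    destruct (multicusp_deriv m x) as [D1' D2'].
    (* [TRe] allows any function [D] that is a derivative near the base point; here it is identified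
       with the explicit velocity. *)
    pose proof (hasderiv_unique _ _ _ _ D1 D1') as ED1.
    pose proof (hasderiv_unique _ _ _ _ D2 D2') as ED2.
    assert (E1 : fst (P (f m x)) = eta m x * fst (cusp_velocity m x) + e1 x).
    { unfold e1; simpl. rewrite Hab2, Ea; simpl. rewrite ED1. simpl; ring. }
    assert (E2 : snd (P (f m x)) = eta m x * snd (cusp_velocity m x) + e2 x).
    { unfold e2; simpl. rewrite Hab2, Ea; simpl. rewrite ED2. simpl; ring. }
    rewrite (form_multicusp _ (fun p => fst (P p)) m x HP1) in E1.
    rewrite (form_multicusp _ (fun p => snd (P p)) m x HP2) in E2.
    specialize (M1 (x - s m)); specialize (M2 (x - s m)); specialize (MN (x - s m)).
    unfold cross in MN at 1; simpl in MN, E1, E2. unfold h, q, e.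
    set (t := x - s m) in *. set (W := (t * t) ^ i) in *.
    set (p1 := fst (P (c_ m + t * - s_ m, s_ m + t * c_ m))) in *.
    set (p2 := snd (P (c_ m + t * - s_ m, s_ m + t * c_ m))) in *.
    transitivity (((1 + 1) * - s_ m - (1 + 1 + 1) * t * c_ m) * (W * p1)
      + ((1 + 1) * c_ m - (1 + 1 + 1) * t * s_ m) * (W * p2)).
    - transitivity (W * ((1 + 1) * ((c_ m + t * - s_ m) * p2 - (s_ m + t * c_ m) * p1)
         - t * (c_ m * p1 + s_ m * p2))); [| ring].
      rewrite MN, M1, M2. unfold N1, T0; ring.
    - rewrite E1, E2; ring. }
  destruct Ve as (C & r & HC & Hr & Ve).
  destruct (poly1_cont h 0 Ph 1%R Rlt_0_1) as (r3 & Hr3 & Hh).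
  assert (Hz : (1 + 1) * cross P (c_ m, s_ m) = 0 /\ (1 + 1) * N1 - T0 = 0).
  { apply (affine_eq0 _ _ (C + (norm (h 0) + 1)) (Rmin r (Rmin r3 (Rmin r1 r2)))).
    - pose proof (Knorm_pos (h 0)); lra.
    - repeat apply Rmin_pos; assumption.
    - intros t Ht0 Ht. pose proof (Rmin_l r (Rmin r3 (Rmin r1 r2))).
      pose proof (Rmin_r r (Rmin r3 (Rmin r1 r2))).
      pose proof (Rmin_l r3 (Rmin r1 r2)); pose proof (Rmin_r r3 (Rmin r1 r2)).
      specialize (Key (s m + t)). specialize (Ve (s m + t)). specialize (Hh t).
      replace (s m + t - s m) with t in Key, Ve by ring. replace (t - 0) with t in Hh by ring.
      specialize (Key ltac:(lra)); specialize (Ve ltac:(lra)); specialize (Hh ltac:(lra)).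
      rewrite <- Key, Knorm_mul, Knorm_pow, Knorm_mul in Ve.
      assert (Pt : 0 < norm t).
      { destruct (Knorm_pos t) as [| E]; [assumption |]. exfalso; apply Ht0, Knorm_eq0; auto. }
      replace (2 * S i)%nat with (2 * i + 2)%nat in Ve by lia.
      rewrite pow_add, pow_mult in Ve. replace (norm t * norm t)%R with (norm t ^ 2)%R in Ve by ring.
      set (Q := ((norm t ^ 2) ^ i)%R) in *.
      assert (PQ : 0 < Q) by (apply pow_lt, pow_lt; assumption).
      set (z := (1 + 1) * cross P (c_ m, s_ m) + t * ((1 + 1) * N1 - T0) + t * t * h t) in *.
      assert (Hz : norm z <= C * norm t ^ 2).
      { apply Rmult_le_reg_l with Q; [assumption |]. eapply Rle_trans; [exact Ve |]. right; ring. }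
      replace ((1 + 1) * cross P (c_ m, s_ m) + ((1 + 1) * N1 - T0) * t) with (z - t * t * h t)
        by (unfold z; ring).
      eapply Rle_trans; [apply Knorm_sub_triang |]. rewrite !Knorm_mul.
      assert (norm (h t) <= norm (h 0) + 1).
      { replace (h t) with (h 0 + (h t - h 0)) by ring.
        eapply Rle_trans; [apply Knorm_triang |]. lra. }
      nra. }
  destruct Hz as [Z1 Z2]; split.
  - destruct (Kmul_eq0 _ _ Z1) as [C0 |]; [| assumption].
    rewrite <- KofR_add in C0. apply KofR_inj in C0; lra.
  - now apply Ksub_eq0.
Qed.

End Multicusp.

(** * Passage from leading forms to germs and conclusion *)

(** The determinant is sin(th j - th l). If it vanished, the difference would be an integer multiple
    of pi of absolute value below 2 pi, that is 0 or plus or minus pi, which the hypotheses on the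
    angles exclude. *)
Lemma lines_independent (th : nat -> R) (i j l : nat) :
  (forall j, (j <= i)%nat -> (0 <= th j < 2 * PI)%R) ->
  (forall j l, (j <= i)%nat -> (l <= i)%nat -> j <> l ->
     th j <> th l /\ Rabs (th j - th l) <> PI) ->
  (j <= i)%nat -> (l <= i)%nat -> j <> l ->
  KofR k (cos (th l)) * KofR k (sin (th j)) - KofR k (sin (th l)) * KofR k (cos (th j)) <> 0.
Proof.
  intros Hth Hthd Hj Hl Hjl E.
  assert (Hsin : sin (th j - th l) = 0%R).
  { rewrite sin_minus. apply KofR_inj. rewrite <- E.
    rewrite <- !KofR_mul; unfold Ksub; rewrite <- KofR_opp, <- KofR_add. f_equal; ring. }
  destruct (Hthd j l Hj Hl Hjl) as [Hne Habs].
  pose proof (Hth j Hj); pose proof (Hth l Hl). pose proof PI_RGT_0.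
  destruct (sin_eq_0_0 _ Hsin) as (z & Hz).
  assert (Hlo : (-2 < z)%Z) by (apply lt_IZR; simpl; nra).
  assert (Hhi : (z < 2)%Z) by (apply lt_IZR; simpl; nra).
  assert (z = -1 \/ z = 0 \/ z = 1)%Z as [-> | [-> | ->]] by lia.
  - apply Habs. rewrite Hz. replace (-1 * PI)%R with (- PI)%R by ring.
    rewrite Rabs_Ropp; apply Rabs_pos_eq; lra.
  - apply Hne; lra.
  - apply Habs. rewrite Hz, Rmult_1_l; apply Rabs_pos_eq; lra.
Qed.

Lemma mem_mtheta_ext l (xi xi' : P2 k -> P2 k) :
  (forall p, xi p = xi' p) -> mem_mtheta k l xi -> mem_mtheta k l xi'.
Proof. intros E; apply functional_extensionality in E; now subst. Qed.

Lemma mem_mtheta_leading_vform i xi : mem_mtheta k i xi ->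
  exists P, vform i P /\ mem_mtheta k (S i) (fun p => P2sub k (xi p) (P p)).
Proof.
  intros [H1 H2]. destruct (mem_m_leading_form i _ H1) as (P1 & F1 & M1).
  destruct (mem_m_leading_form i _ H2) as (P2 & F2 & M2).
  exists (fun p => (P1 p, P2 p)); repeat split; try assumption; apply M1 || apply M2.
Qed.

(** The sum of the leading forms has degree i and is O(|p|^(i+1)), hence zero. The argument uses
    orders of vanishing, which are easily added, instead of closure of m_0^(i+1) under sums. *)
Lemma vform_eq0_of_vanishing_sum i n (xis Q : nat -> P2 k -> P2 k) :
  (forall j, (j < n)%nat -> vform i (Q j)) ->
  (forall j, (j < n)%nat -> mem_mtheta k (S i) (fun p => P2sub k (xis j p) (Q j p))) ->
  mem_mtheta k (S i) (fun p => P2sum k n xis p) ->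
  forall p, P2sum k n Q p = P2zero k.
Proof.
  intros HQ HR [S1 S2] p. destruct (vform_sum i n Q HQ) as [F1 F2].
  assert (V : vanishes (S i) (fun p => fst (P2sum k n xis p) - fst (P2sum k n Q p)) /\
              vanishes (S i) (fun p => snd (P2sum k n xis p) - snd (P2sum k n Q p))).
  { clear S1 S2 F1 F2 HQ. induction n as [| n IH].
    - assert (Z : vanishes (S i) (fun _ => 0)) by exact (mem_m_vanishes _ _ (form_mem_m _ _ (form_zero _))).
      split; apply (vanishes_ext _ _ _ 1 Rlt_0_1) with (2 := Z); intros; simpl; ring.
    - destruct IH as [I1 I2]; [auto |].
      destruct (HR n (Nat.lt_succ_diag_r n)) as [R1 R2].
      apply mem_m_vanishes in R1, R2.
      assert (Z : vanishes (S i) (fun _ => 0)) by exact (mem_m_vanishes _ _ (form_mem_m _ _ (form_zero _))).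
      split.
      + apply (vanishes_ext _ _ _ 1 Rlt_0_1) with (2 := vanishes_sub _ _ _ I1 (vanishes_sub _ _ _ Z R1)).
        intros; simpl; ring.
      + apply (vanishes_ext _ _ _ 1 Rlt_0_1) with (2 := vanishes_sub _ _ _ I2 (vanishes_sub _ _ _ Z R2)).
        intros; simpl; ring. }
  destruct V as [V1 V2]. apply mem_m_vanishes in S1, S2.
  rewrite (surjective_pairing (P2sum k n Q p)); unfold P2zero; f_equal.
  - apply (dform_eq0_of_vanishes (S i) _ F1).
    apply (vanishes_ext _ _ _ 1 Rlt_0_1) with (2 := vanishes_sub _ _ _ S1 V1). intros; ring.
  - apply (dform_eq0_of_vanishes (S i) _ F2).
    apply (vanishes_ext _ _ _ 1 Rlt_0_1) with (2 := vanishes_sub _ _ _ S2 V2). intros; ring.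
Qed.

End Field.

Theorem theorem2 (k : Kfield) (i : nat) (th : nat -> R) (s : nat -> Kt k)
  (Hi : (1 <= i)%nat)
  (Hth : forall j, (j <= i)%nat -> 0 <= th j < 2 * PI)
  (Hthd : forall j l, (j <= i)%nat -> (l <= i)%nat -> j <> l ->
            th j <> th l /\ Rabs (th j - th l) <> PI)
  (Hs : forall j l, (j <= i)%nat -> (l <= i)%nat -> j <> l -> s j <> s l) :
  (* the kernels span m_0^i theta_0(2) / m_0^{i+1} theta_0(2) *)
  (forall xi, mem_mtheta k i xi ->
     exists xis : nat -> P2 k -> P2 k,
       (forall j, (j <= i)%nat ->
          ker_omega k i (Jhat i j) s (multicusp k th s) (xis j)) /\
       mem_mtheta k (S i) (fun p => P2sub k (xi p) (P2sum k (S i) xis p))) /\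
  (* and the sum is direct *)
  (forall xis : nat -> P2 k -> P2 k,
     (forall j, (j <= i)%nat ->
        ker_omega k i (Jhat i j) s (multicusp k th s) (xis j)) ->
     mem_mtheta k (S i) (fun p => P2sum k (S i) xis p) ->
     forall j, (j <= i)%nat -> mem_mtheta k (S i) (xis j)).
Proof.
  set (va := fun j => KofR k (cos (th j))). set (vb := fun j => KofR k (sin (th j))).
  assert (Hunit : forall j, (j <= i)%nat ->
    Kadd k (Kmul k (va j) (va j)) (Kmul k (vb j) (vb j)) = KofR k 1)
    by (intros; apply unit_line).
  assert (Hindep : forall j l, (j <= i)%nat -> (l <= i)%nat -> j <> l ->
    Ksub k (Kmul k (va l) (vb j)) (Kmul k (vb l) (va j)) <> KofR k 0).
  { intros j l Hj Hl Hjl. exact (lines_independent th i j l Hth Hthd Hj Hl Hjl). }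
  split.
  - intros xi Hxi. destruct (mem_mtheta_leading_vform i xi Hxi) as (P & HP & HR).
    destruct (vform_decomposition va vb i Hunit Hindep P HP) as (Q & H & HQ & HS).
    (* The forms themselves serve as representatives of the kernel classes. *)
    exists Q; split.
    + intros j Hj. destruct (HQ j Hj) as (Fj & Pj & Zj).
      apply (ker_omega_intro th s i _ _ (H j) Hi Fj Pj).
      (* [Jhat i j] omits branch [j], the only one on whose line [H j] may be nonzero. *)
      intros m [Hm Hmj]; now apply Zj.
    + revert HR; apply mem_mtheta_ext; intros p; now rewrite HS.
  - intros xis Hker Hsum.
    (* Leading forms of the given germs with their images under psi. Once these forms are shown to
       be zero, each germ equals its own remainder in m_0^(i+1). *)
    destruct (bounded_choice ((P2 k -> P2 k) * (P2 k -> P2 k))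
      ((fun _ => P2zero k), (fun _ => P2zero k))
      (fun j PG => vform i (fst PG) /\
         mem_mtheta k (S i) (fun p => P2sub k (xis j p) (fst PG p)) /\
         psi (fst PG) (snd PG)) (S i)) as (PG & HPG).
    { intros j Hj.
      destruct (mem_mtheta_leading_vform i (xis j)) as (P & HP & HR).
      { apply (Hker j); apply Nat.lt_succ_r; exact Hj. }
      destruct (psi_exists i P HP) as (G & HG). exists (P, G); auto. }
    assert (H0 : forall j, (j <= i)%nat -> forall p, fst (PG j) p = P2zero k).
    { apply (vform_independence va vb i Hunit Hindep (fun j => fst (PG j)) (fun j => snd (PG j))).
      - intros j Hj. destruct (HPG j) as (Fj & Rj & Pj); [now apply Nat.lt_succ_r |].
        repeat split; try apply Fj; try assumption.
        intros m Hm Hmj.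
        exact (ker_omega_elim th s i _ _ _ _ m (Hker j Hj) Fj Rj Pj (conj Hm Hmj)).
      - apply (vform_eq0_of_vanishing_sum i (S i) xis); [| | exact Hsum];
          intros j Hj; now apply HPG. }
    intros j Hj. destruct (HPG j) as (_ & Rj & _); [now apply Nat.lt_succ_r |].
    revert Rj; apply mem_mtheta_ext; intros p. rewrite (H0 j Hj).
    apply P2sub_zero_r.
Qed.
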